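(* Let $B,\Delta B\in\mathbb{C}^{m\times n}$ with $m\ge n$, and let $B(t)=B+t\,\Delta B$ for $t\in\mathbb{R}$. Let $r_1,\dots,r_k$ be positive integers with $r_1+\cdots+r_k=n$. Suppose that for all $t\in\mathbb{R}$ $$B(t)=W(t)\begin{bmatrix}\Sigma(t)\\0\end{bmatrix}V(t)^H,\qquad \Sigma(t)=\mathrm{diag}(\Sigma_1(t),\ldots,\Sigma_k(t)),$$ where $\Sigma_j(t)\in\mathbb{C}^{r_j\times r_j}$ are analytic in $t$ (not necessarily diagonal), $W(t)=[W_1(t),\ldots,W_k(t),W_{k+1}(t)]\in\mathbb{C}^{m\times m}$ and $V(t)=[V_1(t),\ldots,V_k(t)]\in\mathbb{C}^{n\times n}$ are unitary and analytic in $t$, with $W_j(t)\in\mathbb{C}^{m\times r_j}$, $V_j(t)\in\mathbb{C}^{n\times r_j}$ for $j=1,\dots,k$ and $W_{k+1}(t)\in\mathbb{C}^{m\times(m-n)}$, and $$W_j(t)^H\dot W_j(t)=0,\ \ j=1,\ldots,k+1,\qquad V_j(t)^H\dot V_j(t)=0,\ \ j=1,\ldots,k .$$ Define $$\rho_{1i}(t)=\min_{\sigma_1\in\sigma(\Sigma_1(t)),\ \sigma_2\in\sigma(\Sigma_i(t))}|\sigma_1-\sigma_2|,\qquad \rho_1(t)=\min_{i\ne 1}\rho_{1i}(t),\qquad \sigma_{1,\min}(t)=\min\sigma(\Sigma_1(t)),$$ $$\widehat\rho_1(t)=\min\{\rho_1(t),\sigma_{1,\min}(t)\},\qquad \rho_{1,\min}=\min_{0\le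 t\le1}\rho_1(t),\qquad \widehat\rho_{1,\min}=\min_{0\le t\le1}\widehat\rho_1(t).$$ Put $W_1=W_1(0)$, $\widetilde W_1=W_1(1)$, $V_1=V_1(0)$, $\widetilde V_1=V_1(1)$, $\Sigma_1=\Sigma_1(0)$, $\widetilde\Sigma_1=\Sigma_1(1)$. If $\|\Delta B\|_2<\widehat\rho_{1,\min}$, then $$2\|\mathrm{Sing}^{\downarrow}(\widetilde\Sigma_1)-\mathrm{Sing}^{\downarrow}(\Sigma_1)\|_F^2+\widehat\rho_{1,\min}^2\|\widetilde W_1-W_1\|_F^2+\rho_{1,\min}^2\|\widetilde V_1-V_1\|_F^2\le\left(\frac{\widehat\rho_{1,\min}}{\widehat\rho_{1,\min}-\|\Delta B\|_2}\right)^2\left(\|\Delta B\,V_1\|_F^2+\|W_1^H\Delta B\|_F^2\right).$$ When $m=n$, if $\|\Delta B\|_2<\rho_{1,\min}$, then $$2\left(1-\frac{\|\Delta B\|_2}{\rho_{1,\min}}\right)^2\|\mathrm{Sing}^{\downarrow}(\widetilde\Sigma_1)-\mathrm{Sing}^{\downarrow}(\Sigma_1)\|_F^2+(\rho_{1,\min}-\|\Delta B\|_2)^2\left(\|\widetilde W_1-W_1\|_F^2+\|\widetilde V_1-V_1\|_F^2\right)\le\|\Delta B\,V_1\|_F^2+\|W_1^H\Delta B\|_F^2 .$$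
   Context: $X^H$ is the conjugate transpose, $\|\cdot\|_F$ the Frobenius norm, $\|\cdot\|_2$ the spectral norm, $\sigma(X)$ the set of singular values of $X$, and $\dot F(t)=dF(t)/dt$. ''Analytic'' means real-analytic in the real variable $t$ (entrywise). For a matrix $X$ with at least as many rows as columns, $\mathrm{Sing}^{\downarrow}(X)$ denotes the square diagonal matrix (of order the number of columns) whose diagonal entries are the singular values of $X$ (with multiplicity) in nonincreasing order. When $m=n$, the block $W_{k+1}(t)$ and the zero block below $\Sigma(t)$ are void, and conditions involving $W_{k+1}$ are absent. Convention for $k=1$: a minimum over the empty set is $+\infty$ (so $\rho_{1,\min}=+\infty$ and $\widehat\rho_1(t)=\sigma_{1,\min}(t)$), with $c/\infty=0$ for finite $c$ and $\infty\cdot0=0$ (in that case $\widetilde V_1=V_1$, and if $m=n$ also $\widetilde W_1=W_1$). *)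

(* Defs.v *)
From mathcomp Require Import all_boot all_order all_algebra.
From mathcomp Require Import complex.
From mathcomp Require Import all_classical all_reals all_analysis.

Set Implicit Arguments.
Unset Strict Implicit.
Unset Printing Implicit Defensive.

Import Order.TTheory GRing.Theory Num.Theory.
Import numFieldNormedType.Exports.

Local Open Scope classical_set_scope.
Local Open Scope ring_scope.
Local Open Scope sesquilinear_scope.

Section Analyticity.
Variable R : realType.

Definition real_analytic (f : R -> R) : Prop :=
  forall t0 : R, exists a : nat -> R,
    \forall t \near t0, pseries a (t - t0) @ \oo --> f t.

Definition analytic_mx (m n : nat) (F : R -> 'M[R[i]]_(m, n)) : Prop :=
  forall i j, real_analytic (fun t => complex.Re (F t i j))
           /\ real_analytic (fun t => complex.Im (F t i j)).

Definition deriv_mx (m n : nat) (F : R -> 'M[R[i]]_(m, n)) (t : R) :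
    'M[R[i]]_(m, n) :=
  \matrix_(i, j) Complex (derive1 (fun s => complex.Re (F s i j)) t)
                         (derive1 (fun s => complex.Im (F s i j)) t).

End Analyticity.

Section SingularValues.
Variable R : realType.

Definition frobnorm (m n : nat) (X : 'M[R[i]]_(m, n)) : R :=
  Num.sqrt (\sum_i \sum_j ComplexField.Normc.normc (X i j) ^+ 2).

(* The n columns of X give n singular values, with multiplicity: the square
   roots of the eigenvalues of X^H X. The order of spectral_diag is
   unspecified, hence the sorting. For m < n this list is padded with zeros
   compared to the usual convention. *)
Definition singular_values (m n : nat) (X : 'M[R[i]]_(m, n)) : seq R :=
  sort >=%R [seq Num.sqrt (complex.Re (spectral_diag (X ^t* *m X) ord0 i))
            | i <- enum 'I_n].

Definition Sing_dec (m n : nat) (X : 'M[R[i]]_(m, n)) : 'M[R[i]]_n :=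
  diag_mx (\row_(i < n) (nth 0 (singular_values X) i)%:C%C).

Definition specnorm (m n : nat) (X : 'M[R[i]]_(m, n)) : R :=
  \big[Num.max/0]_(s <- singular_values X) s.

Local Open Scope ereal_scope.

Definition sing_min (n : nat) (X : 'M[R[i]]_n) : \bar R :=
  \big[mine/+oo]_(s <- singular_values X) s%:E.

Definition sing_gap (n1 n2 : nat) (X : 'M[R[i]]_n1) (Y : 'M[R[i]]_n2) :
    \bar R :=
  \big[mine/+oo]_(s1 <- singular_values X)
    \big[mine/+oo]_(s2 <- singular_values Y) `|s1 - s2|%:E.

End SingularValues.

(* There are k.+1 diagonal blocks, with index ord0 for the distinguished first
   one. Extended reals account for the empty minimum when k = 0. *)
Section Gaps.
Variables (R : realType) (k : nat) (r : 'I_k.+1 -> nat).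
Variable Sigma : forall j : 'I_k.+1, R -> 'M[R[i]]_(r j).
Local Open Scope ereal_scope.

Definition rho1 (t : R) : \bar R :=
  \big[mine/+oo]_(i < k.+1 | i != ord0)
    sing_gap (Sigma ord0 t) (Sigma i t).

Definition rho1_hat (t : R) : \bar R :=
  mine (rho1 t) (sing_min (Sigma ord0 t)).

(* The minima over the compact interval are taken as infima. *)
Definition rho1_min : \bar R := ereal_inf [set rho1 t | t in `[0%R, 1%R]].

Definition rho1_hat_min : \bar R :=
  ereal_inf [set rho1_hat t | t in `[0%R, 1%R]].

End Gaps.

(* Main.v *)
Require Import Defs.
From mathcomp Require Import all_boot all_order all_algebra all_fingroup.
From mathcomp Require Import complex.
From mathcomp Require Import all_classical all_reals all_analysis.
From mathcomp Require Import ring lra.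

Set Implicit Arguments.
Unset Strict Implicit.
Unset Printing Implicit Defensive.

Import Order.TTheory GRing.Theory Num.Theory.
Import numFieldNormedType.Exports.

Local Open Scope ring_scope.
Local Open Scope sesquilinear_scope.

(** The frame condition [V_1^H V_1' = 0], [W_1^H W_1' = 0] turns the derivatives of
the two block equations [B(t) V_1 = W_1 Sigma_1] and [B(t)^H W_1 = V_1 Sigma_1^H]
into Sylvester equations. Multiplying the first by [W_i^H] and the second by [V_i^H]
gives, with [X_i = W_i^H W_1'] and [Y_i = V_i^H V_1'],
  - [W_i^H DB V_1 = X_i Sigma_1 - Sigma_i Y_i] and
    [V_i^H DB^H W_1 = Y_i Sigma_1^H - Sigma_i^H X_i] for [i <> 1] (W_coupling, V_coupling);
  - [Sigma_1' = W_1^H DB V_1] for [i = 1];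
  - [W_(k+1)^H DB V_1 = W_(k+1)^H W_1' Sigma_1] for the remaining columns of [W] (Wlast_coupling).
In singular coordinates the pair of equations with index [i] decouples into 2 x 2
systems whose matrix has the rows [(s, -t)] and [(-t, s)], where [s] and [t] are
singular values of [Sigma_1] and [Sigma_i]; the smallest singular value of such a system is [|s - t|],
so the gap bounds [X_i] and [Y_i] (sylvester_gap), while [W_(k+1)^H W_1'] is controlled
by the smallest singular value of [Sigma_1] (fsq_mul_sing_min). Summing over the
blocks (velocity_bound) yields, for [a <= b] below the two gaps,
  [2 |Sigma_1'|^2 + a^2 |W_1'|^2 + b^2 |V_1'|^2 <= |DB V_1(t)|^2 + |W_1(t)^H DB|^2].

Let [Z] be the stacked curve [(sqrt 2 Sigma_1, a W_1, b V_1)], [g(t)] the square root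
of the right-hand side, and [M] the supremum of [|Z'|] over [0, 1]. The mean value
inequality gives [|Z(t) - Z(0)| <= M] (frobnorm_mean_value), hence
[g(t) <= g(0) + (|DB|_2 / a) M] (G_increment), and since [|Z'| <= g] this closes up to
[(1 - |DB|_2 / a) M <= g(0)]. That bounds [|Z(1) - Z(0)|]
(block_perturbation_bound), and the inequality
[|Sing(X) - Sing(Y)| <= |X - Y|] (mirsky) replaces the first component of [Z] by
singular values. The rest is arithmetic in the extended reals: [rho] is infinite
exactly when there is one block, and then [b] may be taken arbitrarily large, which
forces [V_1(1) = V_1(0)]. *)

(** * Conjugate transposes *)

Section ConjugateTranspose.
Variable R : realType.

Lemma trmxC_mul m n p (X : 'M[R[i]]_(m, n)) (Y : 'M[R[i]]_(n, p)) :
  (X *m Y)^t* = Y^t* *m X^t*.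
Proof. by rewrite trmx_mul map_mxM. Qed.

Lemma trmxCB m n (X Y : 'M[R[i]]_(m, n)) : (X - Y)^t* = X^t* - Y^t*.
Proof. by rewrite linearB /= map_mxB. Qed.

Lemma trmxCD m n (X Y : 'M[R[i]]_(m, n)) : (X + Y)^t* = X^t* + Y^t*.
Proof. by rewrite linearD /= map_mxD. Qed.

Lemma trmxCZ m n (a : R) (X : 'M[R[i]]_(m, n)) :
  (a%:C%C *: X)^t* = a%:C%C *: X^t*.
Proof. by rewrite linearZ /= map_mxZ; congr (_ *: _); exact: conjc_real. Qed.

Lemma unitarymx_mulCl n (U : 'M[R[i]]_n) : U \is unitarymx -> U^t* *m U = 1%:M.
Proof. by move/unitarymxP/mulmx1C. Qed.

End ConjugateTranspose.

(** * The Frobenius inner product *)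

Section Frobenius.
Variable R : realType.
Implicit Types m n p : nat.

(** The real part of the trace form: the Euclidean inner product of the space of
matrices over the reals, which is what the mean value argument needs. *)
Definition fdot m n (X Y : 'M[R[i]]_(m, n)) : R := complex.Re (\tr (X^t* *m Y)).

Definition fsq m n (X : 'M[R[i]]_(m, n)) : R := fdot X X.

Lemma fdotE m n (X Y : 'M[R[i]]_(m, n)) :
  fdot X Y = \sum_i \sum_j (complex.Re (X i j) * complex.Re (Y i j)
                            + complex.Im (X i j) * complex.Im (Y i j)).
Proof.
rewrite /fdot /mxtrace (raddf_sum (@complex.Re R : Rcomplex R -> R)) /=.
rewrite exchange_big /=; apply: eq_bigr => j _.
rewrite mxE (raddf_sum (@complex.Re R : Rcomplex R -> R)) /=.
apply: eq_bigr => i _; rewrite !mxE.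
by case: (X i j) => a b; case: (Y i j) => c d /=; ring.
Qed.

Lemma fsqE m n (X : 'M[R[i]]_(m, n)) :
  fsq X = \sum_i \sum_j (complex.Re (X i j) ^+ 2 + complex.Im (X i j) ^+ 2).
Proof. by rewrite /fsq fdotE. Qed.

Lemma fsq_ge0 m n (X : 'M[R[i]]_(m, n)) : 0 <= fsq X.
Proof.
by rewrite fsqE !sumr_ge0 // => i _; rewrite sumr_ge0 // => j _; rewrite addr_ge0 ?sqr_ge0.
Qed.

Lemma frobnorm_sqr m n (X : 'M[R[i]]_(m, n)) : frobnorm X ^+ 2 = fsq X.
Proof.
rewrite /frobnorm sqr_sqrtr; last first.
  by apply: sumr_ge0 => i _; apply: sumr_ge0 => j _; rewrite sqr_ge0.
rewrite fsqE; apply: eq_bigr => i _; apply: eq_bigr => j _.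
case: (X i j) => a b /=.
by rewrite sqr_sqrtr // addr_ge0 ?sqr_ge0.
Qed.

Lemma fdotC m n (X Y : 'M[R[i]]_(m, n)) : fdot X Y = fdot Y X.
Proof.
by rewrite !fdotE; apply: eq_bigr => i _; apply: eq_bigr => j _; ring.
Qed.

Lemma fdotDr m n (X Y Z : 'M[R[i]]_(m, n)) :
  fdot X (Y + Z) = fdot X Y + fdot X Z.
Proof.
by rewrite /fdot mulmxDr mxtraceD; case: (\tr (_ *m Y)) => ? ?; case: (\tr _).
Qed.

Lemma fdotDl m n (X Y Z : 'M[R[i]]_(m, n)) :
  fdot (Y + Z) X = fdot Y X + fdot Z X.
Proof. by rewrite fdotC fdotDr !(fdotC X). Qed.

Lemma fdotZr m n (a : R) (X Y : 'M[R[i]]_(m, n)) :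
  fdot X (a%:C%C *: Y) = a * fdot X Y.
Proof.
by rewrite /fdot -scalemxAr mxtraceZ; case: (\tr _) => x y /=; ring.
Qed.

Lemma fdotZl m n (a : R) (X Y : 'M[R[i]]_(m, n)) :
  fdot (a%:C%C *: X) Y = a * fdot X Y.
Proof. by rewrite fdotC fdotZr fdotC. Qed.

Lemma fdotNr m n (X Y : 'M[R[i]]_(m, n)) : fdot X (- Y) = - fdot X Y.
Proof. by rewrite /fdot mulmxN raddfN /=; case: (\tr _). Qed.

Lemma fdotNl m n (X Y : 'M[R[i]]_(m, n)) : fdot (- X) Y = - fdot X Y.
Proof. by rewrite fdotC fdotNr fdotC. Qed.

Lemma fsqZ m n (a : R) (X : 'M[R[i]]_(m, n)) : fsq (a%:C%C *: X) = a ^+ 2 * fsq X.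
Proof. by rewrite /fsq fdotZl fdotZr; ring. Qed.

Lemma fsq0 m n : fsq (0 : 'M[R[i]]_(m, n)) = 0.
Proof. by rewrite /fsq /fdot mulmx0 linear0. Qed.

Lemma fsqC m n (X : 'M[R[i]]_(m, n)) : fsq (X^t*) = fsq X.
Proof. by rewrite /fsq /fdot trmxCK mxtrace_mulC. Qed.

Lemma fsq_eq0 m n (X : 'M[R[i]]_(m, n)) : fsq X = 0 -> X = 0.
Proof.
rewrite fsqE => /eqP; rewrite psumr_eq0 => [/allP X0|i _]; last first.
  by apply: sumr_ge0 => j _; rewrite addr_ge0 ?sqr_ge0.
apply/matrixP => i j; rewrite mxE.
have /implyP/(_ isT) := X0 i (mem_index_enum i).
rewrite psumr_eq0 => [/allP/(_ j (mem_index_enum j))/implyP/(_ isT)|k _]; last first.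
  by rewrite addr_ge0 ?sqr_ge0.
rewrite paddr_eq0 ?sqr_ge0 // !sqrf_eq0 => /andP[/eqP a0 /eqP b0].
by move: a0 b0; case: (X i j) => a b /= -> ->.
Qed.

(** The squared norm of [Y - c X] is nonnegative at its minimizer [c]. *)
Lemma fdot_CauchySchwarz m n (X Y : 'M[R[i]]_(m, n)) :
  fdot X Y ^+ 2 <= fsq X * fsq Y.
Proof.
have [X0|X0] := eqVneq (fsq X) 0.
  by rewrite (fsq_eq0 X0) fsq0 mul0r /fdot trmx0 map_mx0 mul0mx linear0 expr0n.
have X_gt0 : 0 < fsq X by rewrite lt_neqAle eq_sym X0 fsq_ge0.
pose c := fdot X Y / fsq X.
have := fsq_ge0 (Y - c%:C%C *: X).
rewrite /fsq fdotDl !fdotDr !fdotNl !fdotNr !fdotZl !fdotZr (fdotC Y X) -/(fsq X) -/(fsq Y).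
rewrite (_ : _ + _ = fsq Y - fdot X Y ^+ 2 / fsq X); last first.
  by rewrite -/(fsq X) /c; field.
by rewrite subr_ge0 ler_pdivrMr // mulrC.
Qed.

Lemma frobnorm_ge0 m n (X : 'M[R[i]]_(m, n)) : 0 <= frobnorm X.
Proof. by rewrite /frobnorm sqrtr_ge0. Qed.

Lemma fdot_le_frobnorm m n (X Y : 'M[R[i]]_(m, n)) :
  fdot X Y <= frobnorm X * frobnorm Y.
Proof.
apply: le_trans (ler_norm _) _.
rewrite -(@ler_pXn2r _ 2) ?nnegrE ?mulr_ge0 ?frobnorm_ge0 //.
by rewrite real_normK ?num_real // exprMn !frobnorm_sqr fdot_CauchySchwarz.
Qed.

Lemma frobnormD m n (X Y : 'M[R[i]]_(m, n)) :
  frobnorm (X + Y) <= frobnorm X + frobnorm Y.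
Proof.
rewrite -(@ler_pXn2r _ 2) ?nnegrE ?addr_ge0 ?frobnorm_ge0 //.
rewrite sqrrD !frobnorm_sqr /fsq fdotDl !fdotDr (fdotC Y X) -/(fsq X) -/(fsq Y).
by have := fdot_le_frobnorm X Y; lra.
Qed.

Lemma fsq_mulUl m n p (U : 'M[R[i]]_(m, n)) (X : 'M[R[i]]_(n, p)) :
  U^t* *m U = 1%:M -> fsq (U *m X) = fsq X.
Proof.
by move=> U1; rewrite /fsq /fdot trmxC_mul -mulmxA (mulmxA _ U) U1 mul1mx.
Qed.

Lemma fsq_mulUr m n p (U : 'M[R[i]]_(n, p)) (X : 'M[R[i]]_(m, n)) :
  U \is unitarymx -> fsq (X *m U) = fsq X.
Proof.
move=> /unitarymxP U1; rewrite -fsqC trmxC_mul fsq_mulUl ?fsqC //.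
by rewrite trmxCK.
Qed.

Lemma fsq_col_mx m1 m2 n (X : 'M[R[i]]_(m1, n)) (Y : 'M[R[i]]_(m2, n)) :
  fsq (col_mx X Y) = fsq X + fsq Y.
Proof.
rewrite !fsqE big_split_ord /=; congr (_ + _);
  apply: eq_bigr => i _; apply: eq_bigr => j _.
- by rewrite col_mxEu.
- by rewrite col_mxEd.
Qed.

End Frobenius.

(** * Singular value decomposition *)

Section SingularValueDecomposition.
Variable R : realType.
Implicit Types m n p : nat.

Definition rdiag n (s : 'I_n -> R) : 'M[R[i]]_n := diag_mx (\row_i (s i)%:C%C).

Lemma rdiagE n (s : 'I_n -> R) i j : rdiag s i j = (s i *+ (i == j))%:C%C.
Proof. by rewrite !mxE; case: eqP => // ->; rewrite mulr1n. Qed.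

Lemma eq_rdiag n (s t : 'I_n -> R) : s =1 t -> rdiag s = rdiag t.
Proof. by move=> st; congr diag_mx; apply/rowP => i; rewrite !mxE st. Qed.

Lemma rdiagC n (s : 'I_n -> R) : (rdiag s)^t* = rdiag s.
Proof.
apply/matrixP => i j; rewrite 2!mxE !rdiagE (eq_sym j).
by case: eqP => [->|_]; exact: conjc_real.
Qed.

Lemma rdiagM n (s t : 'I_n -> R) : rdiag s *m rdiag t = rdiag (fun i => s i * t i).
Proof.
rewrite mul_diag_mx; apply/matrixP => i j; rewrite mxE !rdiagE mxE -rmorphM /=.
by case: eqP => [_|_]; rewrite ?mulr1n ?mulr0n ?mulr0.
Qed.

Lemma rdiag1 n : rdiag (fun=> 1) = 1%:M :> 'M[R[i]]_n.
Proof. by apply/matrixP => i j; rewrite rdiagE mxE; case: eqP. Qed.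

Lemma rdiagB n (s t : 'I_n -> R) : rdiag s - rdiag t = rdiag (fun i => s i - t i).
Proof. by apply/matrixP => i j; rewrite !mxE !rmorphB mulrnBl. Qed.

Lemma rdiag0 n : rdiag (fun=> 0) = 0 :> 'M[R[i]]_n.
Proof. by apply/matrixP => i j; rewrite rdiagE mxE mul0rn. Qed.

Lemma mx_rdiag m n (X : 'M[R[i]]_(m, n)) s i j :
  (X *m rdiag s) i j = X i j * (s j)%:C%C.
Proof. by rewrite mul_mx_diag !mxE. Qed.

Lemma rdiag_mx m n (X : 'M[R[i]]_(m, n)) s i j :
  (rdiag s *m X) i j = (s i)%:C%C * X i j.
Proof. by rewrite mul_diag_mx !mxE. Qed.

(** Indexed by [nat] with default value 0, so that the sequence is nonincreasing and
nonnegative over all of [nat] and can be summed by parts. *)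
Definition sv m n (X : 'M[R[i]]_(m, n)) (i : nat) : R := nth 0 (singular_values X) i.

Lemma size_singular_values m n (X : 'M[R[i]]_(m, n)) : size (singular_values X) = n.
Proof. by rewrite size_sort size_map size_enum_ord. Qed.

Lemma sv_mem m n (X : 'M[R[i]]_(m, n)) (i : 'I_n) : sv X i \in singular_values X.
Proof. by rewrite mem_nth // size_singular_values. Qed.

Lemma sv_ge0 m n (X : 'M[R[i]]_(m, n)) i : 0 <= sv X i.
Proof.
rewrite /sv; have [lt_i|ge_i] := ltnP i (size (singular_values X)); last by rewrite nth_default.
by have := mem_nth 0 lt_i; rewrite mem_sort => /mapP[j _ ->]; rewrite sqrtr_ge0.
Qed.

Lemma sv_nonincreasing m n (X : 'M[R[i]]_(m, n)) i j : (i <= j)%N -> sv X j <= sv X i.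
Proof.
move=> le_ij; have [lt_j|ge_j] := ltnP j (size (singular_values X)); last first.
  by rewrite {1}/sv nth_default // sv_ge0.
apply: (@sorted_leq_nth _ >=%R) => //.
- by move=> y x z /= xy yz; apply: le_trans yz xy.
- by move=> x /=.
- by rewrite /singular_values; apply: sort_sorted => x y; exact: le_total.
- by rewrite inE (leq_ltn_trans le_ij).
Qed.

(** The spectral theorem for [X^H X], with the eigenvectors permuted so that they
follow the sorted singular values. *)
Lemma gram_spectral m n (X : 'M[R[i]]_(m, n)) :
  exists2 P : 'M[R[i]]_n, P \is unitarymx &
    X^t* *m X = P^t* *m rdiag (fun i => sv X i ^+ 2) *m P.
Proof.
set N := X^t* *m X.
have NC : N^t* = N by rewrite /N trmxC_mul trmxCK.
have /orthomx_spectralP Nspec : N \is normalmx by apply/normalmxP; rewrite NC.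
set P := spectralmx N in Nspec; set d := spectral_diag N in Nspec.
have Pu : P \is unitarymx by exact: spectral_unitarymx.
rewrite invmx_unitary // in Nspec.
have dE : diag_mx d = (X *m P^t*)^t* *m (X *m P^t*).
  rewrite trmxC_mul trmxCK !mulmxA -(mulmxA P) -/N Nspec !mulmxA.
  by rewrite (unitarymxP _) // mul1mx mulmxtVK.
have d_ge0 i : 0 <= d ord0 i.
  have -> : d ord0 i = diag_mx d i i by rewrite mxE eqxx mulr1n.
  rewrite dE mxE sumr_ge0 // => k _; rewrite 2!mxE mulrC.
  exact: mul_conjC_ge0.
pose s i := Num.sqrt (complex.Re (d ord0 i)).
have sE i : d ord0 i = (s i ^+ 2)%:C%C.
  have := d_ge0 i; rewrite /s; case: (d ord0 i) => a b.
  by rewrite lecE /= => /andP[/eqP -> a0]; rewrite sqr_sqrtr.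
have [q qE] : exists q : 'S_n, forall i : 'I_n, sv X i = s (q i).
  have szs : size (singular_values X) == n by rewrite size_singular_values.
  have szt : size [seq s i | i <- enum 'I_n] == n by rewrite size_map size_enum_ord.
  have : perm_eq (Tuple szs) (Tuple szt) by rewrite /= perm_sort.
  case/tuple_permP => q /= qE; exists q => i.
  rewrite /sv qE (nth_map i) ?size_enum_ord // nth_ord_enum /tnth /=.
  by rewrite (nth_map i) ?size_enum_ord // nth_ord_enum.
exists (row_perm q P).
  apply/unitarymxP/matrixP => i j.
  have /unitarymxP/matrixP/(_ (q i) (q j)) := Pu.
  rewrite !mxE (inj_eq perm_inj) => <-.
  by apply: eq_bigr => k _; rewrite !mxE.
apply/matrixP => i j; rewrite {1}Nspec !mxE (reindex_inj (@perm_inj _ q)).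
apply: eq_bigr => k _; rewrite mx_rdiag mul_mx_diag !mxE qE sE.
by congr (_ * _ * _).
Qed.

(** The columns of [U] selected by [e] are orthonormal and the others vanish. As long
as some column vanishes, [U] is singular, and a unit vector of the kernel of [U^H]
can be put in its place. *)
Lemma unitary_completion n (e : pred 'I_n) (U : 'M[R[i]]_n) :
  U^t* *m U = rdiag (fun i => (e i)%:R) ->
  exists2 U' : 'M[R[i]]_n, U' \is unitarymx & U' *m rdiag (fun i => (e i)%:R) = U.
Proof.
have [N] := ubnP #|[pred i | ~~ e i]|; elim: N e U => // N IH e U le_N UE.
set E := rdiag _ in UE *.
have EE : E *m E = E.
  by rewrite rdiagM; apply: eq_rdiag => i; rewrite -natrM mulnb andbb.
(* The columns outside [e] have norm zero. *)
have UE0 : U *m (1%:M - E) = 0.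
  apply: fsq_eq0; rewrite /fsq /fdot trmxC_mul trmxCB rdiagC -mulmxA (mulmxA _ U) UE.
  by rewrite mulmxBr mulmx1 EE subrr mulmx0 linear0.
have UEU : U *m E = U by apply/esym/eqP; rewrite -subr_eq0 -{1}[U]mulmx1 -mulmxBr UE0.
have [/eqP|] := boolP (#|[pred i | ~~ e i]| == 0%N).
  move=> /card0_eq e1; exists U => //; apply/unitarymxP/mulmx1C; rewrite UE.
  apply/matrixP => i j; rewrite rdiagE mxE; have /negbFE -> := e1 i.
  by case: (_ == _).
rewrite -lt0n => /card_gt0P [i ei0]; have ei : ~~ e i by [].
have : kermx U != 0.
  rewrite kermx_eq0 row_free_unit; apply: contra ei => Uu.
  have : 1%:M - E = 0 by rewrite -[LHS](mulKmx Uu) UE0 mulmx0.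
  move=> /matrixP/(_ i i)/eqP; rewrite !mxE eqxx mulr1n subr_eq0.
  by case: (e i) => //; rewrite oner_eq0.
move=> /rowV0Pn[v /sub_kermxP vU v0].
pose c := (frobnorm (v^t*))^-1.
pose u := c%:C%C *: v^t*.
have uu : u^t* *m u = 1%:M.
  apply/matrixP => i0 j0; rewrite !ord1 {i0 j0}.
  have n0 : frobnorm (v^t*) != 0.
    apply: contra v0 => /eqP nv0.
    have : fsq (v^t*) = 0 by rewrite -frobnorm_sqr nv0 expr0n.
    by rewrite fsqC => /fsq_eq0 ->.
  have -> : u^t* *m u = (c ^+ 2)%:C%C *: (v *m v^t*).
    by rewrite /u trmxCZ trmxCK -scalemxAl -scalemxAr scalerA -rmorphM.
  have vv : (v *m v^t*) 0 0 = (fsq v)%:C%C.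
    rewrite mxE fsqE big_ord1 rmorph_sum; apply: eq_bigr => k _; rewrite !mxE.
    by rewrite -normCK -add_Re2_Im2.
  rewrite mxE vv -fsqC -frobnorm_sqr -rmorphM mxE eqxx /c; congr (_%:C%C).
  by field.
have uU : U^t* *m u = 0.
  by rewrite /u -scalemxAr -trmxC_mul vU trmx0 map_mx0 scaler0.
have Uu : u^t* *m U = 0.
  by rewrite -[LHS]trmxCK trmxC_mul trmxCK uU trmx0 map_mx0.
pose e' : pred 'I_n := fun j => (j == i) || e j.
have e'E : rdiag (fun j => (e' j)%:R) = E + delta_mx i i.
  apply/matrixP => j k; rewrite rdiagE !mxE /e'.
  case: (eqVneq j k) => [<-|jk]; rewrite ?andbb ?mulr0n ?mulr1n.
    by case: eqVneq => [->|_] /=; rewrite ?(negbTE ei) ?add0r ?addr0; case: (e j).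
  by case: (eqVneq j i) => [ji|_] /=; rewrite ?addr0 // -ji eq_sym (negbTE jk) addr0.
have [] := IH e' (U + u *m delta_mx 0 i).
- rewrite -ltnS; apply: leq_trans le_N; rewrite ltnS [ltnRHS](cardD1 i) (_ : i \in _) // add1n ltnS.
  by apply/eq_leq/eq_card => j; rewrite !inE negb_or.
- rewrite trmxCD trmxC_mul mulmxDl !mulmxDr UE e'E -addrA; congr (_ + _).
  rewrite mulmxA uU mul0mx add0r -mulmxA Uu mulmx0 add0r -mulmxA (mulmxA _ u) uu mul1mx.
  rewrite (_ : _^t* = delta_mx i 0) ?mul_delta_mx //.
  apply/matrixP => j k; rewrite !mxE andbC.
  by case: (_ && _); [exact: conjc1|exact: conjc0].
move=> U' U'u U'E; exists U' => //.
have -> : E = rdiag (fun j => (e' j)%:R) *m E.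
  rewrite rdiagM; apply: eq_rdiag => j; rewrite /e'.
  by case: (e j); rewrite ?orbT ?mulr1 ?mulr0.
rewrite mulmxA U'E mulmxDl UEU -mulmxA (_ : delta_mx 0 i *m E = 0) ?mulmx0 ?addr0 //.
apply/matrixP => j k; rewrite mx_rdiag !mxE.
by case: (eqVneq k i) => [->|_]; rewrite ?(negbTE ei) ?mulr0 ?andbF ?mul0r.
Qed.

(** With [X^H X = P^H S^2 P], the columns of [X P^H] are orthogonal with norms [S].
Dividing the nonzero ones by their norms leaves a partial isometry, whose completion
is the left factor. *)
Lemma svd n (X : 'M[R[i]]_n) :
  exists U P : 'M[R[i]]_n, [/\ U \is unitarymx, P \is unitarymx &
    X = U *m rdiag (sv X) *m P].
Proof.
have [P Pu XX] := gram_spectral X.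
pose s (i : 'I_n) := sv X i; pose e i := s i != 0.
pose T := X *m P^t*.
have TT : T^t* *m T = rdiag (fun i => s i ^+ 2).
  rewrite trmxC_mul trmxCK !mulmxA -(mulmxA P) XX !mulmxA.
  by rewrite (unitarymxP _) // mul1mx mulmxtVK.
have TE : T *m rdiag (fun i => (e i)%:R) = T.
  apply/eqP; rewrite eq_sym -subr_eq0 -{1}[T]mulmx1 -mulmxBr -rdiag1 rdiagB; apply/eqP.
  apply: fsq_eq0; rewrite /fsq /fdot trmxC_mul rdiagC -mulmxA (mulmxA _ T) TT !rdiagM.
  rewrite (eq_rdiag (t := fun=> 0)) ?rdiag0 ?linear0 // => i.
  rewrite /e; case: eqP => [->|_] /=; first by rewrite expr0n mul0r mulr0.
  by rewrite subrr mul0r.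
pose U0 := T *m rdiag (fun i => (s i)^-1).
have UU : U0^t* *m U0 = rdiag (fun i => (e i)%:R).
  rewrite trmxC_mul rdiagC -mulmxA (mulmxA _ T) TT !rdiagM; apply: eq_rdiag => i.
  rewrite /e; case: eqP => [->|/eqP si]; first by rewrite invr0 mul0r.
  by rewrite /=; field.
have [U Uu UE] := unitary_completion UU.
exists U, P; split => //.
have -> : rdiag (sv X) = rdiag (fun i => (e i)%:R) *m rdiag s :> 'M[R[i]]_n.
  rewrite rdiagM; apply: eq_rdiag => i.
  by rewrite /e -/(s i); case: eqP => [->|_]; rewrite ?mulr0 ?mul1r.
rewrite (mulmxA U) UE /U0 -(mulmxA T) rdiagM.
rewrite (_ : rdiag _ = rdiag (fun i => (e i)%:R)) ?mulmxA ?TE ?mulmxKtV //.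
by apply: eq_rdiag => i; rewrite /e; case: eqP => [->|/eqP si]; rewrite ?mulr0 // mulVf.
Qed.
End SingularValueDecomposition.

(** * Bounds by singular values *)

Section UnitaryChangeOfBasis.
Variable R : realType.

Lemma unitarymx_trmxC n (U : 'M[R[i]]_n) : U \is unitarymx -> U^t* \is unitarymx.
Proof. by rewrite trmxC_unitary. Qed.

Lemma unitarymx_mul n (U V : 'M[R[i]]_n) :
  U \is unitarymx -> V \is unitarymx -> U *m V \is unitarymx.
Proof.
move=> Uu /unitarymxP VV; apply/unitarymxP.
by rewrite trmxC_mul mulmxA -(mulmxA U) VV mulmx1 (elimT unitarymxP Uu).
Qed.

(** In singular coordinates for both [S1] and [S2] the coefficients of the operator
[(X, Y) |-> X S1 - S2 Y] become the diagonal matrices [D1] and [D2]. *)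
Lemma sylvester_unitary n1 n2 (S1 U1 D1 P1 : 'M[R[i]]_n1) (S2 U2 D2 P2 : 'M[R[i]]_n2)
    (X Y : 'M[R[i]]_(n2, n1)) :
  S1 = U1 *m D1 *m P1 -> S2 = U2 *m D2 *m P2 -> U2 \is unitarymx -> P1 \is unitarymx ->
  U2^t* *m (X *m S1 - S2 *m Y) *m P1^t*
    = (U2^t* *m X *m U1) *m D1 - D2 *m (P2 *m Y *m P1^t*).
Proof.
move=> -> -> U2u P1u; have U2CU2 : U2^t* *m U2 = 1%:M by apply/mulmx1C/unitarymxP.
have P1P1 := elimT unitarymxP P1u.
by rewrite mulmxBr mulmxBl !mulmxA -(mulmxA _ P1) P1P1 mulmx1 U2CU2 mul1mx.
Qed.

(** The adjoint equation is diagonalized by the same substitution, so that the two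
equations can be compared entry by entry. *)
Lemma sylvester_unitaryC n1 n2 (S1 U1 D1 P1 : 'M[R[i]]_n1) (S2 U2 D2 P2 : 'M[R[i]]_n2)
    (X Y : 'M[R[i]]_(n2, n1)) :
  S1 = U1 *m D1 *m P1 -> S2 = U2 *m D2 *m P2 -> U1 \is unitarymx -> P2 \is unitarymx ->
  D1^t* = D1 -> D2^t* = D2 ->
  P2 *m (Y *m S1^t* - S2^t* *m X) *m U1
    = (P2 *m Y *m P1^t*) *m D1 - D2 *m (U2^t* *m X *m U1).
Proof.
move=> -> -> U1u P2u D1C D2C; rewrite !trmxC_mul D1C D2C mulmxBr mulmxBl !mulmxA.
have P2P2 := elimT unitarymxP P2u; have U1U1 := unitarymx_mulCl U1u.
by rewrite -(mulmxA _ (U1^t*)) U1U1 mulmx1 P2P2 mul1mx.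
Qed.

Lemma unitary_difference n (S1 U1 D1 P1 S2 U2 D2 P2 : 'M[R[i]]_n) :
  S1 = U1 *m D1 *m P1 -> S2 = U2 *m D2 *m P2 -> U2 \is unitarymx -> P1 \is unitarymx ->
  U2^t* *m (S1 - S2) *m P1^t* = (U2^t* *m U1) *m D1 - D2 *m (P2 *m P1^t*).
Proof.
move=> S1E S2E U2u P1u.
by have := sylvester_unitary 1%:M 1%:M S1E S2E U2u P1u; rewrite mul1mx !mulmx1.
Qed.

End UnitaryChangeOfBasis.

Section SingularValueInequalities.
Variable R : realType.
Implicit Types m n p : nat.

Lemma mx_rdiagB m n (X Y : 'M[R[i]]_(m, n)) s t i j :
  (X *m rdiag s - rdiag t *m Y) i j = X i j * (s j)%:C%C - (t i)%:C%C * Y i j.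
Proof. by rewrite mxE mx_rdiag [X in _ + X]mxE rdiag_mx. Qed.

Definition normc2 (z : R[i]) : R := complex.Re z ^+ 2 + complex.Im z ^+ 2.

Lemma normc2_ge0 z : 0 <= normc2 z.
Proof. by rewrite addr_ge0 ?sqr_ge0. Qed.

Lemma normc2Z (a : R) z : normc2 (a%:C%C * z) = a ^+ 2 * normc2 z.
Proof. by case: z => x y; rewrite /normc2 /=; ring. Qed.

Lemma normc2Zr (a : R) z : normc2 (z * a%:C%C) = a ^+ 2 * normc2 z.
Proof. by rewrite mulrC normc2Z. Qed.

Lemma specnorm_ge0 m n (X : 'M[R[i]]_(m, n)) : 0 <= specnorm X.
Proof. by rewrite /specnorm; elim/big_rec: _ => // s x _ x0; rewrite le_max x0 orbT. Qed.

Lemma le_specnorm m n (X : 'M[R[i]]_(m, n)) s :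
  s \in singular_values X -> s <= specnorm X.
Proof.
rewrite /specnorm; elim: (singular_values X) => // a l IH.
rewrite inE big_cons le_max => /orP[/eqP->|/IH ->]; first by rewrite lexx.
by rewrite orbT.
Qed.

Lemma fsq_mul_specnorm m n p (X : 'M[R[i]]_(m, n)) (Y : 'M[R[i]]_(n, p)) :
  fsq (X *m Y) <= specnorm X ^+ 2 * fsq Y.
Proof.
have [P Pu XX] := gram_spectral X.
have -> : fsq (X *m Y) = fsq (rdiag (fun i : 'I_n => sv X i) *m (P *m Y)).
  have SS : rdiag (fun i : 'I_n => sv X i ^+ 2)
            = rdiag (fun i => sv X i) *m rdiag (fun i => sv X i) by rewrite rdiagM.
  rewrite /fsq /fdot (_ : _ *m (X *m Y) = Y^t* *m (X^t* *m X) *m Y).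
    by rewrite XX SS !trmxC_mul rdiagC !mulmxA.
  by rewrite trmxC_mul !mulmxA.
rewrite -(fsq_mulUl Y (unitarymx_mulCl Pu)) !fsqE mulr_sumr; apply: ler_sum => i _.
rewrite mulr_sumr; apply: ler_sum => j _; rewrite rdiag_mx -!/(normc2 _) normc2Z.
rewrite ler_wpM2r ?normc2_ge0 // lerXn2r ?nnegrE ?sv_ge0 ?specnorm_ge0 //.
by rewrite le_specnorm // sv_mem.
Qed.

(** [X] and [X^H] have the same spectral norm: with [Z = X^H Y],
[|Z|^2 = <Y, X Z> <= |Y| |X|_2 |Z|]. *)
Lemma fsq_mulC_specnorm m n p (X : 'M[R[i]]_(m, n)) (Y : 'M[R[i]]_(m, p)) :
  fsq (X^t* *m Y) <= specnorm X ^+ 2 * fsq Y.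
Proof.
set Z := X^t* *m Y.
have [->|Z0] := eqVneq (fsq Z) 0; first by rewrite mulr_ge0 ?fsq_ge0 ?sqr_ge0.
have Z_gt0 : 0 < fsq Z by rewrite lt_neqAle eq_sym Z0 fsq_ge0.
have ZE : fsq Z = fdot Y (X *m Z).
  rewrite /fsq /fdot (mulmxA (Y^t*)); congr (complex.Re (\tr (_ *m _))).
  by rewrite /Z trmxC_mul trmxCK.
have := fdot_CauchySchwarz Y (X *m Z); rewrite -ZE => le1.
have le2 : fsq Y * fsq (X *m Z) <= fsq Y * (specnorm X ^+ 2 * fsq Z).
  by rewrite ler_wpM2l ?fsq_ge0 ?fsq_mul_specnorm.
by rewrite -(ler_pM2r Z_gt0) -expr2 (le_trans le1) // (le_trans le2) // mulrCA mulrA.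
Qed.

(** In singular coordinates the two right-hand sides are, entrywise, [x s - t y] and
[y s - t x]. Since [s] and [t] are nonnegative,
[|x s - t y|^2 + |y s - t x|^2 - (s - t)^2 (|x|^2 + |y|^2) = 2 s t |x - y|^2 >= 0]. *)
Lemma sylvester_gap n1 n2 (S1 : 'M[R[i]]_n1) (S2 : 'M[R[i]]_n2)
    (X Y : 'M[R[i]]_(n2, n1)) (b : R) :
  0 <= b ->
  (forall s1 s2, s1 \in singular_values S1 -> s2 \in singular_values S2 ->
     b <= `|s1 - s2|) ->
  b ^+ 2 * (fsq X + fsq Y)
    <= fsq (X *m S1 - S2 *m Y) + fsq (Y *m S1^t* - S2^t* *m X).
Proof.
move=> b0 gap.
have [U1 [P1 [U1u P1u S1E]]] := svd S1; have [U2 [P2 [U2u P2u S2E]]] := svd S2.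
have U2Cu := unitarymx_trmxC U2u; have P1Cu := unitarymx_trmxC P1u.
pose X' := U2^t* *m X *m U1; pose Y' := P2 *m Y *m P1^t*.
have -> : fsq X = fsq X'.
  by rewrite -(fsq_mulUr X U1u) -(fsq_mulUl _ (unitarymx_mulCl U2Cu)) mulmxA.
have -> : fsq Y = fsq Y'.
  by rewrite -(fsq_mulUr Y P1Cu) -(fsq_mulUl _ (unitarymx_mulCl P2u)) mulmxA.
have -> : fsq (X *m S1 - S2 *m Y) = fsq (X' *m rdiag (sv S1) - rdiag (sv S2) *m Y').
  rewrite -(fsq_mulUl _ (unitarymx_mulCl U2Cu)) -(fsq_mulUr _ P1Cu); congr fsq.
  exact: sylvester_unitary.
have -> : fsq (Y *m S1^t* - S2^t* *m X) = fsq (Y' *m rdiag (sv S1) - rdiag (sv S2) *m X').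
  rewrite -(fsq_mulUl _ (unitarymx_mulCl P2u)) -(fsq_mulUr _ U1u); congr fsq.
  by apply: sylvester_unitaryC => //; exact: rdiagC.
rewrite !fsqE -!big_split /= mulr_sumr; apply: ler_sum => i _.
rewrite -!big_split /= mulr_sumr; apply: ler_sum => j _.
have gij : b ^+ 2 <= (sv S1 j - sv S2 i) ^+ 2.
  rewrite -[leRHS]real_normK ?num_real // lerXn2r ?nnegrE //.
  by rewrite gap ?sv_mem.
rewrite !mx_rdiagB.
have := sv_ge0 S1 j; have := sv_ge0 S2 i; move: gij.
move: (sv S1 j) (sv S2 i) => s t gij t0 s0.
case: (X' i j) => x1 x2; case: (Y' i j) => y1 y2 /=.
apply: le_trans (ler_wpM2r _ gij) _; first by rewrite !addr_ge0 ?sqr_ge0.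
rewrite -subr_ge0.
set lhs := (X in 0 <= X).
have -> : lhs = 2 * (s * t) * ((x1 - y1) ^+ 2 + (x2 - y2) ^+ 2) by rewrite /lhs; ring.
by rewrite !mulr_ge0 ?addr_ge0 ?sqr_ge0.
Qed.

Lemma fsq_mul_sing_min m n (S : 'M[R[i]]_n) (X : 'M[R[i]]_(m, n)) (a : R) :
  0 <= a -> (forall s, s \in singular_values S -> a <= s) ->
  a ^+ 2 * fsq X <= fsq (X *m S).
Proof.
move=> a0 gap; have [U [P [Uu Pu SE]]] := svd S.
rewrite -(fsq_mulUr _ Uu) SE 2!mulmxA (fsq_mulUr _ Pu) !fsqE mulr_sumr.
apply: ler_sum => i _; rewrite mulr_sumr; apply: ler_sum => j _.
rewrite mx_rdiag -!/(normc2 _) normc2Zr ler_wpM2r ?normc2_ge0 // lerXn2r ?nnegrE ?sv_ge0 //.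
by rewrite gap ?sv_mem.
Qed.

(** Linear programming duality for the assignment problem with costs [t_i s_j]: the
potentials [u_i = t_i s_i - v_i] and [v_j] satisfy [t_i s_j <= u_i + v_j], with
equality on the diagonal. *)
Lemma doubly_stochastic_rearrangement n (s t : nat -> R) (w : 'I_n -> 'I_n -> R) :
  (forall i j, (i <= j)%N -> s j <= s i) -> (forall i j, (i <= j)%N -> t j <= t i) ->
  (forall i j, 0 <= w i j) ->
  (forall i, \sum_j w i j = 1) -> (forall j, \sum_i w i j = 1) ->
  \sum_i \sum_j w i j * (t i * s j) <= \sum_(i < n) t i * s i.
Proof.
move=> s_dec t_dec w_ge0 w_row w_col.
pose v j := \sum_(l < j) (s l.+1 - s l) * t l.
have vS j : v j.+1 = v j + (s j.+1 - s j) * t j by rewrite /v big_ord_recr.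
(* Each increment [(s_(l+1) - s_l) t_l] of [v] is compared with [(s_(l+1) - s_l) t_i],
   in the direction given by the monotonicity of [s] and [t]. *)
have dual i j : (s j - s i) * t i <= v j - v i.
  have [le_ij|/ltnW le_ji] := leqP i j.
    rewrite -(subnK le_ij) addnC; elim: (j - i)%N => [|d IH]; first by rewrite addn0; lra.
    rewrite addnS vS.
    have : (s (i + d)%N.+1 - s (i + d)%N) * t i <= (s (i + d)%N.+1 - s (i + d)%N) * t (i + d)%N.
      by rewrite ler_wnM2l ?subr_le0 ?s_dec ?t_dec // leq_addr.
    lra.
  rewrite -(subKn le_ji); have := leq_subr j i.
  elim: (i - j)%N => [|d IH] lt_di; first by rewrite subn0; lra.
  have := IH (ltnW lt_di); rewrite -(subnSK lt_di) vS.
  have : (s (i - d.+1).+1 - s (i - d.+1)%N) * t (i - d.+1)%N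
         <= (s (i - d.+1).+1 - s (i - d.+1)%N) * t i.
    by rewrite ler_wnM2l ?subr_le0 ?s_dec ?t_dec // leq_subr.
  lra.
have le1 : \sum_i \sum_j w i j * (t i * s j)
           <= \sum_(i < n) \sum_(j < n) w i j * (t i * s i - v i)
              + \sum_(i < n) \sum_(j < n) w i j * v j.
  rewrite -big_split; apply: ler_sum => i _; rewrite -big_split; apply: ler_sum => j _ /=.
  by rewrite -mulrDr ler_wpM2l //; have := dual i j; lra.
apply: le_trans le1 _; rewrite [X in _ + X]exchange_big /=.
have -> : \sum_(i < n) \sum_(j < n) w i j * (t i * s i - v i) = \sum_(i < n) (t i * s i - v i).
  by apply: eq_bigr => i _; rewrite -mulr_suml w_row mul1r.
have -> : \sum_(j < n) \sum_(i < n) w i j * v j = \sum_(j < n) v j.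
  by apply: eq_bigr => j _; rewrite -mulr_suml w_col mul1r.
by rewrite -big_split /=; apply: ler_sum => i _; lra.
Qed.

Lemma unitary_row_sum n (U : 'M[R[i]]_n) i : U \is unitarymx -> \sum_j normc2 (U i j) = 1.
Proof.
move=> /unitarymxP/matrixP/(_ i i); rewrite !mxE eqxx => UU.
apply: (@complexI R); rewrite -[RHS]UU rmorph_sum; apply: eq_bigr => j _.
by rewrite !mxE -normCK -add_Re2_Im2.
Qed.

Lemma unitary_col_sum n (U : 'M[R[i]]_n) j : U \is unitarymx -> \sum_i normc2 (U i j) = 1.
Proof.
rewrite -trmx_unitary => /(unitary_row_sum j) <-.
by apply: eq_bigr => i _; rewrite mxE.
Qed.

(** Expanding [|Q D1 - D2 T|^2] for unitary [Q] and [T] leaves the cross terms, and these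
are weighted by the doubly stochastic matrix of the averages of [|Q_ij|^2] and
[|T_ij|^2]; the rearrangement inequality bounds them. *)
Lemma mirsky n (X Y : 'M[R[i]]_n) : fsq (Sing_dec X - Sing_dec Y) <= fsq (X - Y).
Proof.
have [U1 [P1 [U1u P1u XE]]] := svd X; have [U2 [P2 [U2u P2u YE]]] := svd Y.
have U2Cu := unitarymx_trmxC U2u; have P1Cu := unitarymx_trmxC P1u.
pose Q := U2^t* *m U1; pose T := P2 *m P1^t*.
have Qu := unitarymx_mul U2Cu U1u; rewrite -/Q in Qu.
have Tu := unitarymx_mul P2u P1Cu; rewrite -/T in Tu.
have -> : fsq (X - Y) = fsq (Q *m rdiag (sv X) - rdiag (sv Y) *m T).
  rewrite -(fsq_mulUl _ (unitarymx_mulCl U2Cu)) -(fsq_mulUr _ P1Cu); congr fsq.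
  exact: unitary_difference.
have -> : fsq (Sing_dec X - Sing_dec Y) = \sum_(i < n) (sv X i - sv Y i) ^+ 2.
  rewrite -[Sing_dec X]/(rdiag (sv X)) -[Sing_dec Y]/(rdiag (sv Y)) rdiagB fsqE.
  apply: eq_bigr => i _; rewrite (bigD1 i) //= big1 => [|j ji]; rewrite rdiagE.
    by rewrite eqxx mulr1n /=; ring.
  by rewrite eq_sym (negbTE ji) /=; ring.
pose w i j := (normc2 (Q i j) + normc2 (T i j)) / 2.
have w_row i : \sum_j w i j = 1.
  by rewrite -mulr_suml big_split /= (unitary_row_sum i Qu) (unitary_row_sum i Tu); field.
have w_col j : \sum_i w i j = 1.
  by rewrite -mulr_suml big_split /= (unitary_col_sum j Qu) (unitary_col_sum j Tu); field.
have w_ge0 i j : 0 <= w i j by rewrite divr_ge0 ?ler0n // addr_ge0 ?normc2_ge0.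
have := doubly_stochastic_rearrangement
  (@sv_nonincreasing _ _ _ X) (@sv_nonincreasing _ _ _ Y) w_ge0 w_row w_col.
move=> le_w.
have le1 : \sum_(i < n) \sum_(j < n) (sv X j ^+ 2 * normc2 (Q i j) + sv Y i ^+ 2 * normc2 (T i j)
              - 2 * (w i j * (sv Y i * sv X j)))
     <= fsq (Q *m rdiag (sv X) - rdiag (sv Y) *m T).
  rewrite fsqE; apply: ler_sum => i _; apply: ler_sum => j _.
  rewrite mx_rdiagB /w /normc2.
  have := sv_ge0 X j; have := sv_ge0 Y i.
  move: (sv X j) (sv Y i) => s t t0 s0.
  case: (Q i j) => x1 x2; case: (T i j) => y1 y2 /=.
  rewrite -subr_ge0.
  set lhs := (X in 0 <= X).
  have -> : lhs = (s * t) * ((x1 - y1) ^+ 2 + (x2 - y2) ^+ 2) by rewrite /lhs; field.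
  by rewrite !mulr_ge0 ?addr_ge0 ?sqr_ge0.
apply: le_trans le1.
have QX : \sum_(i < n) \sum_(j < n) sv X j ^+ 2 * normc2 (Q i j) = \sum_(j < n) sv X j ^+ 2.
  rewrite exchange_big; apply: eq_bigr => j _.
  by rewrite -mulr_sumr (unitary_col_sum j Qu) mulr1.
have TY : \sum_(i < n) \sum_(j < n) sv Y i ^+ 2 * normc2 (T i j) = \sum_(i < n) sv Y i ^+ 2.
  by apply: eq_bigr => i _; rewrite -mulr_sumr (unitary_row_sum i Tu) mulr1.
have W2 : \sum_(i < n) \sum_(j < n) 2 * (w i j * (sv Y i * sv X j))
          = 2 * \sum_(i < n) \sum_(j < n) w i j * (sv Y i * sv X j).
  by rewrite mulr_sumr; apply: eq_bigr => i _; rewrite mulr_sumr.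
under [X in _ <= X]eq_bigr do rewrite sumrB big_split.
rewrite [X in _ <= X]sumrB big_split QX TY W2.
have -> : \sum_(i < n) (sv X i - sv Y i) ^+ 2 = \sum_(i < n) sv X i ^+ 2
  + \sum_(i < n) sv Y i ^+ 2 - 2 * \sum_(i < n) sv Y i * sv X i.
  by rewrite mulr_sumr -big_split -sumrB /=; apply: eq_bigr => i _; ring.
by rewrite lerD2l lerN2 ler_wpM2l.
Qed.

End SingularValueInequalities.

(** * Real-analytic functions are differentiable *)

Section AnalyticDerivable.
Local Open Scope classical_set_scope.
Variable R : realType.

(** The terms [c_i x^i] are bounded, and [i + 1 <= 2^i] turns the factor [4^-i] into the
geometric factor [2^-i]. *)
Lemma is_cvg_pseries_diffs_quarter (c : R^nat) (x : R) :
  x != 0 -> cvgn (pseries c x) -> cvgn (pseries (pseries_diffs c) (x / 4)).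
Proof.
move=> x0 /cvg_series_bounded[M0 [_ M0P]]; pose M := `|M0| + 1.
have M_ge0 : 0 <= M by rewrite addr_ge0.
have cM i : `|c i * x ^+ i| <= M.
  by apply: M0P => //; rewrite /M (le_lt_trans (ler_norm _)) // ltrDl.
apply: normed_cvg.
apply: (@series_le_cvg _ _ (geometric (M / `|x|) 2^-1)).
- by move=> i /=.
- by move=> i /=; rewrite mulr_ge0 ?divr_ge0 ?exprn_ge0 // invr_ge0.
- move=> i /=; rewrite /pseries_diffs.
  have -> : i.+1%:R * c i.+1 * (x / 4) ^+ i
            = (c i.+1 * x ^+ i.+1) / x * (i.+1%:R * 4^-1 ^+ i).
    by rewrite exprMn exprS; field.
  have le1 : `|c i.+1 * x ^+ i.+1 / x| <= M / `|x|.
    by rewrite normrM normfV ler_wpM2r ?invr_ge0.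
  have le2 : `|i.+1%:R * 4^-1 ^+ i| <= 2^-1 ^+ i :> R.
    rewrite ger0_norm ?mulr_ge0 ?exprn_ge0 ?invr_ge0 ?ler0n //.
    have -> : 4^-1 = 2^-1 * 2^-1 :> R by field.
    rewrite exprMn mulrA -[leRHS]mul1r ler_wpM2r ?exprn_ge0 ?invr_ge0 //.
    by rewrite exprVn ler_pdivrMr ?exprn_gt0 // mul1r -natrX ler_nat ltn_expl.
  by rewrite normrM ler_pM.
- by apply: is_cvg_geometric_series; rewrite gtr0_norm ?invr_gt0 // invf_lt1 // ltr1n.
Qed.

(** Analyticity is assumed at every point, so it suffices to differentiate a power
series at its center. *)
Lemma real_analytic_derivable (f : R -> R) t : real_analytic f -> derivable f t 1.
Proof.
move=> /(_ t)[a fa].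
have [e /= e0 fe] := fa.
pose x := e / 2.
have x_gt0 : 0 < x by rewrite divr_gt0.
have ax : cvgn (pseries a x).
  have := fe (t + x); rewrite /ball /= opprD addNKr normrN gtr0_norm //.
  rewrite /x ltr_pdivrMr // ltr_pMr // ltr1n => /(_ isT).
  rewrite (addrC t) addrK; exact: cvgP.
have a1 := is_cvg_pseries_diffs_quarter (lt0r_neq0 x_gt0) ax.
have x4_gt0 : 0 < x / 4 by rewrite divr_gt0.
(* Two termwise derivatives have to converge somewhere off the center. *)
have a2 := is_cvg_pseries_diffs_quarter (lt0r_neq0 x4_gt0) a1.
have K_gt0 : 0 < x / 4 / 4 by rewrite divr_gt0.
have lt4 (y : R) : 0 < y -> `|y / 4| < `|y|.
  by move=> y0; rewrite !gtr0_norm ?divr_gt0 // ltr_pdivrMr // ltr_pMr // ltr1n.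
have K0 : `|0 : R| < `|x / 4 / 4| by rewrite normr0 normr_gt0 lt0r_neq0.
have a0' := is_cvg_pseries_inside (is_cvg_pseries_inside ax (lt4 _ x_gt0)) (lt4 _ x4_gt0).
have a1' := is_cvg_pseries_inside a1 (lt4 _ x4_gt0).
have d0 := pseries_snd_diffs a0' a1' a2 K0.
have : is_derive t 1 ((fun y => limn (pseries a y)) \o (fun s => s - t))
         (limn (pseries (pseries_diffs a) 0) * 1).
  apply: is_derive1_comp; first by rewrite subrr.
  rewrite -[X in is_derive _ _ _ X]subr0; exact: is_deriveB.
move=> [der _]; apply: near_eq_derivable der.
apply: filterS fa => s fs.
by apply/cvg_lim.
Qed.

End AnalyticDerivable.

(** * Derivatives of complex matrix curves *)

Section MatrixCalculus.
Variable R : realType.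

(** Differentiation of a complex function of a real variable, through its real and
imaginary parts as in [deriv_mx]. *)
Definition cder (f : R -> R[i]) (t : R) (d : R[i]) : Prop :=
  is_derive t 1 (fun s => complex.Re (f s)) (complex.Re d) /\
  is_derive t 1 (fun s => complex.Im (f s)) (complex.Im d).

Definition mxder m n (F : R -> 'M[R[i]]_(m, n)) (t : R) (D : 'M[R[i]]_(m, n)) : Prop :=
  forall i j, cder (fun s => F s i j) t (D i j).

Lemma cderM (f g : R -> R[i]) t df dg : cder f t df -> cder g t dg ->
  cder (fun s => f s * g s) t (df * g t + f t * dg).
Proof.
move=> [fR fI] [gR gI]; split.
  pose h := ((fun s => complex.Re (f s)) * (fun s => complex.Re (g s)) -
     (fun s => complex.Im (f s)) * (fun s => complex.Im (g s)) : R -> R).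
  have -> : (fun s => complex.Re (f s * g s)) = h.
    by apply/funext => s; rewrite /h !fctE /=; case: (f s) => a b; case: (g s).
  apply: is_derive_eq (is_deriveB (is_deriveM fR gR) (is_deriveM fI gI)) _.
  by case: (f t) (g t) df dg
    {fR fI gR gI} => [a b] [c d] [e u] [v w] /=; rewrite /GRing.scale /=; ring.
pose h := ((fun s => complex.Re (f s)) * (fun s => complex.Im (g s)) +
   (fun s => complex.Im (f s)) * (fun s => complex.Re (g s)) : R -> R).
have -> : (fun s => complex.Im (f s * g s)) = h.
  by apply/funext => s; rewrite /h !fctE /=; case: (f s) => a b; case: (g s).
apply: is_derive_eq (is_deriveD (is_deriveM fR gI) (is_deriveM fI gR)) _.
by case: (f t) (g t) df dg
  {fR fI gR gI} => [a b] [c d] [e u] [v w] /=; rewrite /GRing.scale /=; ring.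
Qed.

Lemma cderD (f g : R -> R[i]) t df dg : cder f t df -> cder g t dg ->
  cder (fun s => f s + g s) t (df + dg).
Proof.
move=> [fR fI] [gR gI]; split.
  pose h := ((fun s => complex.Re (f s)) + (fun s => complex.Re (g s)) : R -> R).
  have -> : (fun s => complex.Re (f s + g s)) = h.
    by apply/funext => s; rewrite /h !fctE /=; case: (f s) => a b; case: (g s).
  by rewrite (_ : complex.Re _ = complex.Re df + complex.Re dg);
    [exact: is_deriveD|case: df {fR fI} => ? ?; case: dg {gR gI}].
pose h := ((fun s => complex.Im (f s)) + (fun s => complex.Im (g s)) : R -> R).
have -> : (fun s => complex.Im (f s + g s)) = h.
  by apply/funext => s; rewrite /h !fctE /=; case: (f s) => a b; case: (g s).
by rewrite (_ : complex.Im _ = complex.Im df + complex.Im dg);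
  [exact: is_deriveD|case: df {fR fI} => ? ?; case: dg {gR gI}].
Qed.

Lemma cder_cst (c : R[i]) t : cder (fun=> c) t 0.
Proof. by split; exact: is_derive_cst. Qed.

Lemma cder_id t : cder (fun s => s%:C%C) t 1.
Proof. by split; [exact: is_derive_id|exact: is_derive_cst]. Qed.

Lemma cder_conj (f : R -> R[i]) t d : cder f t d -> cder (fun s => (f s)^*%C) t (d^*%C).
Proof.
move=> [fR fI]; split.
  have -> : (fun s => complex.Re (f s)^*%C) = (fun s => complex.Re (f s)).
    by apply/funext => s; case: (f s).
  by case: d fR {fI}.
have -> : (fun s => complex.Im (f s)^*%C) = - (fun s => complex.Im (f s)).
  by apply/funext => s; rewrite fctE; case: (f s).
by rewrite (_ : complex.Im _ = - complex.Im d); [exact: is_deriveN|case: d {fR fI}].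
Qed.

Lemma cder_sum n (f : 'I_n -> R -> R[i]) t (d : 'I_n -> R[i]) :
  (forall i, cder (f i) t (d i)) -> cder (fun s => \sum_i f i s) t (\sum_i d i).
Proof.
elim: n f d => [|n IH] f d fd.
  rewrite big_ord0 (_ : (fun _ => _) = fun=> 0); first exact: cder_cst.
  by apply/funext => s; rewrite big_ord0.
rewrite big_ord_recl (_ : (fun _ => _) =
   fun s => f ord0 s + \sum_i f (lift ord0 i) s); last first.
  by apply/funext => s; rewrite big_ord_recl.
by apply: cderD => //; apply: IH.
Qed.

Lemma cder_unique (f : R -> R[i]) t d d' : cder f t d -> cder f t d' -> d = d'.
Proof.
move=> [/@derive_val dR /@derive_val dI] [/@derive_val dR' /@derive_val dI'].
by move: dR' dI'; rewrite dR dI; case: d {dR dI} => ? ?; case: d' => ? ? /= -> ->.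
Qed.

Lemma mxder_unique m n (F : R -> 'M[R[i]]_(m, n)) t D D' :
  mxder F t D -> mxder F t D' -> D = D'.
Proof. by move=> FD FD'; apply/matrixP => i j; apply: cder_unique (FD i j) (FD' i j). Qed.

Lemma mxderM m n p (F : R -> 'M[R[i]]_(m, n)) (G : R -> 'M[R[i]]_(n, p)) t DF DG :
  mxder F t DF -> mxder G t DG ->
  mxder (fun s => F s *m G s) t (DF *m G t + F t *m DG).
Proof.
move=> FD GD i j; rewrite !mxE -big_split /=.
rewrite (_ : (fun _ => _) = fun s => \sum_k F s i k * G s k j); last first.
  by apply/funext => s; rewrite mxE.
by apply: cder_sum => k; exact: cderM.
Qed.

Lemma mxder_cst m n (X : 'M[R[i]]_(m, n)) t : mxder (fun=> X) t 0.
Proof. by move=> i j; rewrite mxE; exact: cder_cst. Qed.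

Lemma mxder_cstM m n p (X : 'M[R[i]]_(m, n)) (G : R -> 'M[R[i]]_(n, p)) t D :
  mxder G t D -> mxder (fun s => X *m G s) t (X *m D).
Proof. by move=> /(mxderM (mxder_cst X t)); rewrite mul0mx add0r. Qed.

Lemma mxderC m n (F : R -> 'M[R[i]]_(m, n)) t D :
  mxder F t D -> mxder (fun s => (F s)^t*) t (D^t*).
Proof.
move=> FD i j; rewrite !mxE.
rewrite (_ : (fun _ => _) = fun s => (F s j i)^*%C); last by apply/funext => s; rewrite !mxE.
exact: cder_conj.
Qed.

Lemma mxder_pencil m n (X Y : 'M[R[i]]_(m, n)) t : mxder (fun s => X + s%:C%C *: Y) t Y.
Proof.
move=> i j; rewrite (_ : (fun _ => _) = fun s => X i j + s%:C%C * Y i j); last first.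
  by apply/funext => s; rewrite !mxE.
rewrite -[Y i j]add0r; apply: cderD; first exact: cder_cst.
have := cderM (cder_id t) (cder_cst (Y i j) t).
by rewrite mul1r mulr0 addr0 add0r.
Qed.

Lemma mxderZ m n (a : R) (F : R -> 'M[R[i]]_(m, n)) t D :
  mxder F t D -> mxder (fun s => a%:C%C *: F s) t (a%:C%C *: D).
Proof.
move=> FD i j; rewrite mxE (_ : (fun _ => _) = fun s => a%:C%C * F s i j); last first.
  by apply/funext => s; rewrite mxE.
by have := cderM (cder_cst a%:C%C t) (FD i j); rewrite mul0r add0r.
Qed.

Lemma mxder_col_mx m1 m2 n (F : R -> 'M[R[i]]_(m1, n)) (G : R -> 'M[R[i]]_(m2, n)) t DF DG :
  mxder F t DF -> mxder G t DG -> mxder (fun s => col_mx (F s) (G s)) t (col_mx DF DG).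
Proof.
move=> FD GD i j; case: (split_ordP i) => k ->.
  rewrite col_mxEu (_ : (fun _ => _) = fun s => F s k j) //.
  by apply/funext => s; rewrite col_mxEu.
rewrite col_mxEd (_ : (fun _ => _) = fun s => G s k j) //.
by apply/funext => s; rewrite col_mxEd.
Qed.

Lemma analytic_mxder m n (F : R -> 'M[R[i]]_(m, n)) t :
  analytic_mx F -> mxder F t (deriv_mx F t).
Proof.
move=> Fan i j.
have [/(@real_analytic_derivable _ _ t) FR /(@real_analytic_derivable _ _ t) FI] := Fan i j.
by rewrite mxE; split; apply: DeriveDef; rewrite ?derive1E.
Qed.

(** The scalar mean value theorem for the component of [F] along the direction
[F t - F 0]. *)
Lemma frobnorm_mean_value m n (F : R -> 'M[R[i]]_(m, n)) (dF : R -> 'M[R[i]]_(m, n)) (M t : R) :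
  (forall s, mxder F s (dF s)) -> 0 <= t <= 1 ->
  (forall s : R, 0 <= s <= 1 -> frobnorm (dF s) <= M) ->
  frobnorm (F t - F 0) <= M.
Proof.
move=> FD t01 FM; set U := F t - F 0.
pose h s := fdot U (F s).
have hD (s : R) : is_derive s 1 h (fdot U (dF s)).
  have := mxder_cstM (U^t*) (FD s).
  by move=> UF; apply: (proj1 (cder_sum (fun i => UF i i))).
have [->|U0] := eqVneq (frobnorm U) 0.
  by apply: le_trans (FM 0 _); rewrite ?frobnorm_ge0 // lexx ler01.
have U_gt0 : 0 < frobnorm U by rewrite lt_neqAle eq_sym U0 frobnorm_ge0.
have /andP[t0 t1] := t01.
have [|c] := MVT_segment t0 (fun x _ => hD x).
  apply: derivable_within_continuous => x _; exact: ex_derive.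
rewrite in_itv /= subr0 => /andP[c0 ct] hE.
have UU : h t - h 0 = frobnorm U ^+ 2.
  by rewrite /h -fdotNr -fdotDr frobnorm_sqr.
have le1 : frobnorm U ^+ 2 <= frobnorm U * M.
  have M_ge0 : 0 <= M by apply: le_trans (FM 0 _); rewrite ?frobnorm_ge0 // lexx ler01.
  rewrite -UU hE; apply: le_trans (_ : frobnorm U * M * t <= _); last first.
    by rewrite ler_piMr // mulr_ge0 ?frobnorm_ge0.
  rewrite ler_wpM2r //; apply: le_trans (fdot_le_frobnorm _ _) _.
  by rewrite ler_wpM2l ?frobnorm_ge0 // FM // c0 (le_trans ct).
by rewrite -(ler_pM2l U_gt0) -expr2.
Qed.

End MatrixCalculus.

(** * Block columns of a unitary matrix *)

Section BlockUnitary.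
Variables (R : realType) (k : nat) (r : 'I_k.+1 -> nat).
Local Notation n := (\sum_j r j)%N.

Lemma trmxC_mxrow m (U : forall j, 'M[R[i]]_(m, r j)) :
  (\mxrow_j U j)^t* = \mxcol_j (U j)^t*.
Proof. by apply/matrixP => i j; rewrite !mxE. Qed.

Lemma trmxC_row_mx m n1 n2 (X : 'M[R[i]]_(m, n1)) (Y : 'M[R[i]]_(m, n2)) :
  (row_mx X Y)^t* = col_mx (X^t*) (Y^t*).
Proof. by rewrite tr_row_mx map_col_mx. Qed.

Lemma mxrow_gram m (U : forall j, 'M[R[i]]_(m, r j)) :
  (\mxrow_j U j)^t* *m (\mxrow_j U j) = 1%:M ->
  (forall j, (U j)^t* *m U j = 1%:M) /\ (forall i j, i != j -> (U i)^t* *m U j = 0).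
Proof.
rewrite trmxC_mxrow mul_mxcol_mxrow => UU.
have UE i j : (U i)^t* *m U j = submxblock 1%:M i j by rewrite -UU mxblockK.
split => [j|i j ij]; apply/matrixP => a b; rewrite UE !mxE -val_eqE tagnat.eq_Rank.
  by rewrite eqxx.
by rewrite (negbTE ij).
Qed.

Lemma fsq_mulC m a q (Y : 'M[R[i]]_(m, a)) (X : 'M[R[i]]_(m, q)) :
  fsq (Y^t* *m X) = fdot X (Y *m Y^t* *m X).
Proof.
have -> : fdot X (Y *m Y^t* *m X) = complex.Re (\tr ((X^t* *m Y) *m (Y^t* *m X))).
  by rewrite /fdot !mulmxA.
have -> : X^t* *m Y = (Y^t* *m X)^t* by rewrite trmxC_mul; congr (_ *m _); rewrite trmxCK.
by [].
Qed.

Lemma fsq_mxrow_mulC m q (U : forall j, 'M[R[i]]_(m, r j)) (X : 'M[R[i]]_(m, q)) :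
  fsq ((\mxrow_j U j)^t* *m X) = \sum_j fsq ((U j)^t* *m X).
Proof.
under [RHS]eq_bigr do rewrite fsq_mulC.
rewrite fsq_mulC trmxC_mxrow mul_mxrow_mxcol mulmx_suml.
elim/big_rec2: _ => [|j x Y _ <-]; last by rewrite fdotDr.
by rewrite /fdot mulmx0 linear0.
Qed.

End BlockUnitary.

(** * The differential inequality *)

(** The summation over the blocks: the index [o] carries the derivative [s] of the
distinguished block, the other indices are governed by the gap. The weight [a] of [x]
is traded for the larger [b]. *)
Lemma weighted_sum_bound (R : realType) (I : finType) (x y e f : I -> R) (o : I)
    (a b s xl el : R) :
  (forall i, 0 <= x i) -> 0 <= a -> a <= b ->
  x o = 0 -> y o = 0 -> e o = s -> f o = s ->
  (forall i, i != o -> b ^+ 2 * (x i + y i) <= e i + f i) -> a ^+ 2 * xl <= el ->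
  2 * s + a ^+ 2 * (\sum_i x i + xl) + b ^+ 2 * \sum_i y i
    <= \sum_i e i + el + \sum_i f i.
Proof.
move=> x0 a0 ab xo yo eo fo coupled last.
have ab2 : a ^+ 2 <= b ^+ 2 by rewrite lerXn2r ?nnegrE // (le_trans a0).
have : a ^+ 2 * (\sum_(i | i != o) x i) + b ^+ 2 * (\sum_(i | i != o) y i)
       <= \sum_(i | i != o) e i + \sum_(i | i != o) f i.
  rewrite !mulr_sumr -!big_split /=; apply: ler_sum => i /coupled; apply: le_trans.
  by rewrite mulrDr lerD2r ler_wpM2r.
by rewrite !(bigD1 o (P := xpredT)) //= xo yo eo fo; lra.
Qed.

Section PerturbedBlocks.
Variables (R : realType) (k p : nat) (r : 'I_k.+1 -> nat).
Local Notation n := (\sum_j r j)%N.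
Variables (B DB : 'M[R[i]]_(n + p, n)).
Variables (Sigma : forall j : 'I_k.+1, R -> 'M[R[i]]_(r j)).
Variables (W : forall j : 'I_k.+1, R -> 'M[R[i]]_(n + p, r j)).
Variables (Wlast : R -> 'M[R[i]]_(n + p, p)).
Variables (V : forall j : 'I_k.+1, R -> 'M[R[i]]_(n, r j)).
Hypotheses (Sigma_analytic : forall j, analytic_mx (Sigma j)).
Hypotheses (W_analytic : analytic_mx (fun t => row_mx (\mxrow_j W j t) (Wlast t))).
Hypotheses (V_analytic : analytic_mx (fun t => \mxrow_j V j t)).
Hypotheses (W_unitary : forall t, row_mx (\mxrow_j W j t) (Wlast t) \is unitarymx).
Hypotheses (V_unitary : forall t, \mxrow_j V j t \is unitarymx).
Hypotheses (B_decomp : forall t : R,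
      B + t%:C%C *: DB =
        row_mx (\mxrow_j W j t) (Wlast t)
          *m col_mx (\mxdiag_j Sigma j t) 0
          *m (\mxrow_j V j t) ^t* ).
Hypotheses (W_deriv : forall t, (W ord0 t) ^t* *m deriv_mx (W ord0) t = 0).
Hypotheses (V_deriv : forall t, (V ord0 t) ^t* *m deriv_mx (V ord0) t = 0).

Local Notation Bt t := (B + t%:C%C *: DB).

Lemma right_block_eq j t : Bt t *m V j t = W j t *m Sigma j t.
Proof.
have : Bt t *m (\mxrow_j V j t) = \mxrow_j (W j t *m Sigma j t).
  rewrite B_decomp -mulmxA (unitarymx_mulCl (V_unitary t)) mulmx1 mul_row_col mulmx0 addr0.
  exact: mul_mxrow_mxdiag.
by rewrite mul_mxrow => /eq_mxrowP.
Qed.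

Lemma left_block_eqs t :
  (forall j, (W j t)^t* *m Bt t = Sigma j t *m (V j t)^t*) /\ (Wlast t)^t* *m Bt t = 0.
Proof.
have : (row_mx (\mxrow_j W j t) (Wlast t))^t* *m Bt t
     = col_mx (\mxdiag_j Sigma j t) 0 *m (\mxrow_j V j t)^t*.
  by rewrite B_decomp !mulmxA (unitarymx_mulCl (W_unitary t)) mul1mx.
rewrite trmxC_row_mx !mul_col_mx mul0mx !trmxC_mxrow mxcol_mul mul_mxdiag_mxcol.
by move=> /eq_col_mx[/eq_mxcolP ? ?].
Qed.

Lemma W_gram t : [/\ (W ord0 t)^t* *m W ord0 t = 1%:M,
  forall i, i != ord0 -> (W i t)^t* *m W ord0 t = 0 & (Wlast t)^t* *m W ord0 t = 0].
Proof.
have := unitarymx_mulCl (W_unitary t).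
rewrite trmxC_row_mx mul_col_row scalar_mx_block => /eq_block_mx[WW _ W'W _].
have [W1 W0] := mxrow_gram WW; split => // [i i0|]; first exact: W0.
by move: W'W; rewrite mul_mxrow -[RHS](mxrow0 (q_ := r)) => /eq_mxrowP.
Qed.

Lemma V_gram t : (V ord0 t)^t* *m V ord0 t = 1%:M /\
  forall i, i != ord0 -> (V i t)^t* *m V ord0 t = 0.
Proof.
have [V1 V0] := mxrow_gram (unitarymx_mulCl (V_unitary t)).
by split => // i; exact: V0.
Qed.

Lemma fsq_W_resolution t q (X : 'M[R[i]]_(n + p, q)) :
  fsq X = \sum_j fsq ((W j t)^t* *m X) + fsq ((Wlast t)^t* *m X).
Proof.
rewrite -fsq_mxrow_mulC -fsq_col_mx -mul_col_mx -trmxC_row_mx fsq_mulC.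
by rewrite (elimT unitarymxP (W_unitary t)) mul1mx.
Qed.

Lemma fsq_V_resolution t q (X : 'M[R[i]]_(n, q)) :
  fsq X = \sum_j fsq ((V j t)^t* *m X).
Proof.
by rewrite -fsq_mxrow_mulC fsq_mulC (elimT unitarymxP (V_unitary t)) mul1mx.
Qed.

Local Notation dW := (deriv_mx (W ord0)).
Local Notation dV := (deriv_mx (V ord0)).
Local Notation dS := (deriv_mx (Sigma ord0)).

Lemma mxder_Sigma t : mxder (Sigma ord0) t (dS t).
Proof. exact: analytic_mxder. Qed.

Lemma mxder_W t : mxder (W ord0) t (dW t).
Proof.
apply: analytic_mxder => i j.
have := W_analytic i (lshift p (tagnat.Rank ord0 j)).
suff E s : row_mx (\mxrow_j W j s) (Wlast s) i (lshift p (tagnat.Rank ord0 j)) = W ord0 s i j.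
  by under eq_fun do rewrite E; under [X in _ /\ real_analytic X]eq_fun do rewrite E.
by rewrite row_mxEl -[in RHS](mxrowK (W^~ s) ord0) [RHS]mxE.
Qed.

Lemma mxder_V t : mxder (V ord0) t (dV t).
Proof.
apply: analytic_mxder => i j.
have := V_analytic i (tagnat.Rank ord0 j).
suff E s : (\mxrow_j V j s) i (tagnat.Rank ord0 j) = V ord0 s i j.
  by under eq_fun do rewrite E; under [X in _ /\ real_analytic X]eq_fun do rewrite E.
by rewrite -[in RHS](mxrowK (V^~ s) ord0) [RHS]mxE.
Qed.

Lemma right_block_derivative t :
  DB *m V ord0 t + Bt t *m dV t = dW t *m Sigma ord0 t + W ord0 t *m dS t.
Proof.
apply: mxder_unique (mxderM (mxder_pencil B DB t) (mxder_V t)) _.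
have -> : (fun s => Bt s *m V ord0 s) = (fun s => W ord0 s *m Sigma ord0 s).
  by apply/funext => s; rewrite right_block_eq.
exact: mxderM (mxder_W t) (mxder_Sigma t).
Qed.

Lemma left_block_derivative t :
  DB^t* *m W ord0 t + (Bt t)^t* *m dW t
    = dV t *m (Sigma ord0 t)^t* + V ord0 t *m (dS t)^t*.
Proof.
apply: mxder_unique (mxderM (mxderC (mxder_pencil B DB t)) (mxder_W t)) _.
have -> : (fun s => (Bt s)^t* *m W ord0 s) = (fun s => V ord0 s *m (Sigma ord0 s)^t*).
  apply/funext => s; have [/(_ ord0) E _] := left_block_eqs s.
  by rewrite -[LHS]trmxCK trmxC_mul trmxCK E trmxC_mul trmxCK.
exact: mxderM (mxder_V t) (mxderC (mxder_Sigma t)).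
Qed.

Lemma W_coupling i t :
  (W i t)^t* *m (DB *m V ord0 t)
    = ((W i t)^t* *m dW t *m Sigma ord0 t - Sigma i t *m ((V i t)^t* *m dV t))
      + (W i t)^t* *m W ord0 t *m dS t.
Proof.
have := congr1 (mulmx ((W i t)^t*)) (right_block_derivative t).
have [/(_ i) WB _] := left_block_eqs t.
rewrite !mulmxDr (mulmxA _ (Bt t)) WB -(mulmxA (Sigma i t)) !(mulmxA ((W i t)^t*)) => E.
by rewrite -[LHS](addrK (Sigma i t *m ((V i t)^t* *m dV t))) E addrAC.
Qed.

Lemma V_coupling i t :
  (V i t)^t* *m (DB^t* *m W ord0 t)
    = ((V i t)^t* *m dV t *m (Sigma ord0 t)^t* - (Sigma i t)^t* *m ((W i t)^t* *m dW t))
      + (V i t)^t* *m V ord0 t *m (dS t)^t*.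
Proof.
have VB : (V i t)^t* *m (Bt t)^t* = (Sigma i t)^t* *m (W i t)^t*.
  by rewrite -!trmxC_mul right_block_eq.
have /(congr1 (mulmx ((V i t)^t*))) := left_block_derivative t.
rewrite !mulmxDr (mulmxA _ ((Bt t)^t*)) VB -(mulmxA ((Sigma i t)^t*)) !(mulmxA ((V i t)^t*)) => E.
by rewrite -[LHS](addrK ((Sigma i t)^t* *m ((W i t)^t* *m dW t))) E addrAC.
Qed.

Lemma Wlast_coupling t :
  (Wlast t)^t* *m (DB *m V ord0 t) = (Wlast t)^t* *m dW t *m Sigma ord0 t.
Proof.
have := congr1 (mulmx ((Wlast t)^t*)) (right_block_derivative t).
have [_ _ W'W0] := W_gram t; have [_ W'B] := left_block_eqs t.
rewrite !mulmxDr (mulmxA _ (Bt t)) W'B mul0mx addr0 (mulmxA _ (W ord0 t)) W'W0 mul0mx addr0.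
by move=> ->; rewrite mulmxA.
Qed.

(** The right-hand side is resolved along the orthonormal frames [(W_i, Wlast)] and
[V_i]; each component is given by a coupling equation. *)
Lemma velocity_bound (a b : R) t : 0 <= a -> a <= b ->
  (forall i, i != ord0 -> forall s1 s2,
     s1 \in singular_values (Sigma ord0 t) -> s2 \in singular_values (Sigma i t) ->
     b <= `|s1 - s2|) ->
  (p = 0%N \/ forall s, s \in singular_values (Sigma ord0 t) -> a <= s) ->
  2 * fsq (dS t) + a ^+ 2 * fsq (dW t) + b ^+ 2 * fsq (dV t)
    <= fsq (DB *m V ord0 t) + fsq (DB^t* *m W ord0 t).
Proof.
move=> a0 ab gap last_gap.
have [W00 Wi0 _] := W_gram t; have [V00 Vi0] := V_gram t.
have X0 : fsq ((W ord0 t)^t* *m dW t) = 0 by rewrite W_deriv fsq0.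
have Y0 : fsq ((V ord0 t)^t* *m dV t) = 0 by rewrite V_deriv fsq0.
have E0 : fsq ((W ord0 t)^t* *m (DB *m V ord0 t)) = fsq (dS t).
  by rewrite W_coupling W_deriv V_deriv W00 mul0mx mulmx0 subrr add0r mul1mx.
have F0 : fsq ((V ord0 t)^t* *m (DB^t* *m W ord0 t)) = fsq (dS t).
  by rewrite V_coupling W_deriv V_deriv V00 mul0mx mulmx0 subrr add0r mul1mx fsqC.
have EW i : i != ord0 -> (W i t)^t* *m (DB *m V ord0 t)
    = (W i t)^t* *m dW t *m Sigma ord0 t - Sigma i t *m ((V i t)^t* *m dV t).
  by move=> i0; rewrite W_coupling (Wi0 i i0) mul0mx addr0.
have EV i : i != ord0 -> (V i t)^t* *m (DB^t* *m W ord0 t)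
    = (V i t)^t* *m dV t *m (Sigma ord0 t)^t* - (Sigma i t)^t* *m ((W i t)^t* *m dW t).
  by move=> i0; rewrite V_coupling (Vi0 i i0) mul0mx addr0.
have coupled i : i != ord0 ->
    b ^+ 2 * (fsq ((W i t)^t* *m dW t) + fsq ((V i t)^t* *m dV t))
    <= fsq ((W i t)^t* *m (DB *m V ord0 t)) + fsq ((V i t)^t* *m (DB^t* *m W ord0 t)).
  move=> i0; rewrite (EW i i0) (EV i i0).
  exact: sylvester_gap (le_trans a0 ab) (gap i i0).
have last : a ^+ 2 * fsq ((Wlast t)^t* *m dW t) <= fsq ((Wlast t)^t* *m (DB *m V ord0 t)).
  rewrite Wlast_coupling; case: last_gap => [p0|last_gap]; last exact: fsq_mul_sing_min.
  suff -> : fsq ((Wlast t)^t* *m dW t) = 0 by rewrite mulr0 fsq_ge0.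
  by rewrite fsqE big1 // => i; have := ltn_ord i; rewrite [X in (_ < X)%N]p0 ltn0.
rewrite (fsq_W_resolution t (dW t)) (fsq_V_resolution t (dV t)).
rewrite (fsq_W_resolution t (DB *m _)) (fsq_V_resolution t (DB^t* *m _)).
pose x i := fsq ((W i t)^t* *m dW t).
pose y i := fsq ((V i t)^t* *m dV t).
pose e i := fsq ((W i t)^t* *m (DB *m V ord0 t)).
pose f i := fsq ((V i t)^t* *m (DB^t* *m W ord0 t)).
apply: (@weighted_sum_bound _ _ x y e f ord0) => //.
by move=> i; exact: fsq_ge0.
Qed.

(** The three quantities to be estimated, stacked with their weights into one curve, so
that a single mean value inequality handles them with the right constant. *)
Let Z (a b t : R) : 'M[R[i]]_(r ord0 + (n + p + n), r ord0) :=
  col_mx ((Num.sqrt 2)%:C%C *: Sigma ord0 t)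
         (col_mx (a%:C%C *: W ord0 t) (b%:C%C *: V ord0 t)).

Let dZ (a b t : R) : 'M[R[i]]_(r ord0 + (n + p + n), r ord0) :=
  col_mx ((Num.sqrt 2)%:C%C *: dS t) (col_mx (a%:C%C *: dW t) (b%:C%C *: dV t)).

Let G t : 'M[R[i]]_(n + p + n, r ord0) :=
  col_mx (DB *m V ord0 t) (DB^t* *m W ord0 t).

Lemma mxder_Z a b t : mxder (Z a b) t (dZ a b t).
Proof.
apply: mxder_col_mx; first exact/mxderZ/mxder_Sigma.
by apply: mxder_col_mx; apply: mxderZ; [exact: mxder_W|exact: mxder_V].
Qed.

Lemma fsq_scaled_stack (a b : R) (S : 'M[R[i]]_(r ord0))
    (X : 'M[R[i]]_(n + p, r ord0)) (Y : 'M[R[i]]_(n, r ord0)) :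
  fsq (col_mx ((Num.sqrt 2)%:C%C *: S) (col_mx (a%:C%C *: X) (b%:C%C *: Y)))
    = 2 * fsq S + a ^+ 2 * fsq X + b ^+ 2 * fsq Y.
Proof. by rewrite !fsq_col_mx !fsqZ sqr_sqrtr // addrA. Qed.

Lemma stack_increment a b t u : Z a b t - Z a b u
  = col_mx ((Num.sqrt 2)%:C%C *: (Sigma ord0 t - Sigma ord0 u))
      (col_mx (a%:C%C *: (W ord0 t - W ord0 u)) (b%:C%C *: (V ord0 t - V ord0 u))).
Proof. by rewrite /Z !opp_col_mx !add_col_mx -!scalerBr. Qed.

(** Here [a <= b] allows both increments to be measured with the weight [a]. *)
Lemma G_increment (a b t : R) : 0 < a -> a <= b ->
  frobnorm (G t) <= frobnorm (G 0) + specnorm DB / a * frobnorm (Z a b t - Z a b 0).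
Proof.
move=> a0 ab; rewrite -{1}[G t](subrK (G 0)) addrC (le_trans (frobnormD _ _)) // lerD2l.
rewrite -(@ler_pXn2r _ 2) ?nnegrE ?mulr_ge0 ?frobnorm_ge0 ?invr_ge0 ?specnorm_ge0 ?(ltW a0) //.
rewrite exprMn !frobnorm_sqr stack_increment fsq_scaled_stack.
rewrite /G opp_col_mx add_col_mx -!mulmxBr fsq_col_mx.
have le1 := fsq_mul_specnorm DB (V ord0 t - V ord0 0).
have le2 := fsq_mulC_specnorm DB (W ord0 t - W ord0 0).
apply: le_trans (lerD le1 le2) _.
have ab2 : a ^+ 2 <= b ^+ 2 by rewrite lerXn2r ?nnegrE ?(ltW a0) // (le_trans (ltW a0)).
have aux (D A A' s v w : R) : 0 <= D -> 0 < A -> A <= A' -> 0 <= s -> 0 <= v ->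
    D * v + D * w <= D / A * (2 * s + A * w + A' * v).
  move=> D0 A0 AA' s0 v0; rewrite -mulrDr -mulrA ler_wpM2l // ler_pdivlMl //.
  by have := ler_wpM2r v0 AA'; lra.
rewrite expr_div_n; apply: aux; rewrite ?sqr_ge0 ?exprn_gt0 ?fsq_ge0 //.
Qed.

(** Unitarity bounds the right-hand side uniformly in [t], so that the speed of [Z] has
a finite supremum. *)
Lemma G_bounded t : fsq (G t) <= specnorm DB ^+ 2 * (2 * fsq (1%:M : 'M[R[i]]_(r ord0))).
Proof.
have [W00 _ _] := W_gram t; have [V00 _] := V_gram t.
have V1 : fsq (V ord0 t) = fsq (1%:M : 'M[R[i]]_(r ord0)).
  by rewrite -[V ord0 t]mulmx1 fsq_mulUl.
have W1 : fsq (W ord0 t) = fsq (1%:M : 'M[R[i]]_(r ord0)).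
  by rewrite -[W ord0 t]mulmx1 fsq_mulUl.
have := lerD (fsq_mul_specnorm DB (V ord0 t)) (fsq_mulC_specnorm DB (W ord0 t)).
rewrite -fsq_col_mx V1 W1 => /le_trans; apply.
by rewrite -mulrDr mulr2n mulrDl mul1r.
Qed.

(** The alternative [p = 0] covers square matrices, where no lower bound for the
singular values of [Sigma_1] enters. *)
Lemma block_perturbation_bound (a b : R) :
  specnorm DB < a -> a <= b ->
  (forall t : R, 0 <= t <= 1 -> forall i, i != ord0 -> forall s1 s2,
     s1 \in singular_values (Sigma ord0 t) -> s2 \in singular_values (Sigma i t) ->
     b <= `|s1 - s2|) ->
  (p = 0%N \/ forall t : R, 0 <= t <= 1 ->
     forall s, s \in singular_values (Sigma ord0 t) -> a <= s) ->
  (a - specnorm DB) ^+ 2 *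
    (2 * fsq (Sing_dec (Sigma ord0 1) - Sing_dec (Sigma ord0 0))
     + a ^+ 2 * fsq (W ord0 1 - W ord0 0) + b ^+ 2 * fsq (V ord0 1 - V ord0 0))
  <= a ^+ 2 * (fsq (DB *m V ord0 0) + fsq ((W ord0 0)^t* *m DB)).
Proof.
move=> da ab gap last_gap; set d := specnorm DB in da *.
have d0 : 0 <= d := specnorm_ge0 DB.
have a0 : 0 < a by rewrite (le_lt_trans d0).
have speed t : 0 <= t <= 1 -> frobnorm (dZ a b t) <= frobnorm (G t).
  move=> t01; rewrite -(@ler_pXn2r _ 2) ?nnegrE ?frobnorm_ge0 //.
  rewrite !frobnorm_sqr fsq_scaled_stack fsq_col_mx.
  apply: velocity_bound (ltW a0) ab (gap t t01) _.
  by case: last_gap => [->|/(_ t t01)]; [left|right].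
pose E := [set frobnorm (dZ a b t) | t in [set t : R | 0 <= t <= 1]]%classic.
pose K := Num.sqrt (d ^+ 2 * (2 * fsq (1%:M : 'M[R[i]]_(r ord0)))).
have E_sup : has_sup E.
  split; first by exists (frobnorm (dZ a b 0)); exists 0 => //=; rewrite lexx ler01.
  exists K => _ [t /= t01 <-]; apply: le_trans (speed t t01) _.
  rewrite -[leLHS]ger0_norm ?frobnorm_ge0 // -sqrtr_sqr ler_wsqrtr // frobnorm_sqr.
  exact: G_bounded.
pose M := sup E.
have E_M (t : R) : 0 <= t <= 1 -> frobnorm (dZ a b t) <= M.
  by move=> t01; apply: sup_upper_bound => //; exists t.
have Z_M (t : R) : 0 <= t <= 1 -> frobnorm (Z a b t - Z a b 0) <= M.
  by move=> t01; apply: frobnorm_mean_value t01 E_M => s; exact: mxder_Z.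
(* The speed is bounded in terms of its own supremum, with a factor [d / a < 1]. *)
have M_le : M <= frobnorm (G 0) + d / a * M.
  apply: ge_sup; first by case: E_sup.
  move=> _ [t /= t01 <-]; apply: le_trans (speed t t01) _.
  apply: le_trans (G_increment t a0 ab) _.
  by rewrite lerD2l ler_wpM2l ?Z_M // divr_ge0 // ltW.
have Z1_le : (a - d) * frobnorm (Z a b 1 - Z a b 0) <= a * frobnorm (G 0).
  apply: le_trans (_ : (a - d) * M <= _).
    by rewrite ler_wpM2l ?Z_M ?ler01 ?lexx // subr_ge0 ltW.
  have -> : (a - d) * M = a * (M - d / a * M) by field; rewrite gt_eqF.
  by rewrite ler_pM2l //; lra.
move: Z1_le; rewrite -(@ler_pXn2r _ 2) ?nnegrE ?mulr_ge0 ?frobnorm_ge0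
  ?subr_ge0 ?(ltW a0) ?(ltW da) //.
rewrite !exprMn !frobnorm_sqr stack_increment fsq_scaled_stack fsq_col_mx.
have <- : fsq (DB^t* *m W ord0 0) = fsq ((W ord0 0)^t* *m DB).
  by rewrite -[LHS]fsqC trmxC_mul trmxCK.
apply: le_trans; rewrite ler_wpM2l ?sqr_ge0 // !lerD2r ler_wpM2l //.
exact: mirsky.
Qed.

End PerturbedBlocks.

(** * Real numbers below the extended gaps *)

Section ExtendedGaps.
Variable R : realType.

Lemma bigmine_le_seq (T : eqType) (l : seq T) (F : T -> \bar R) x : x \in l ->
  (\big[mine/+oo]_(s <- l) F s <= F x)%E.
Proof.
elim: l => // a l IH; rewrite inE big_cons ge_min => /orP[/eqP->|/IH ->].
  by rewrite lexx.
by rewrite orbT.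
Qed.

Variables (k : nat) (r : 'I_k.+1 -> nat).
Variable Sigma : forall j : 'I_k.+1, R -> 'M[R[i]]_(r j).

Lemma rho1_min_gap (b t : R) : (b%:E <= rho1_min Sigma)%E -> 0 <= t <= 1 ->
  forall i, i != ord0 -> forall s1 s2,
    s1 \in singular_values (Sigma ord0 t) -> s2 \in singular_values (Sigma i t) ->
    b <= `|s1 - s2|.
Proof.
move=> b_le t01 i i0 s1 s2 s1in s2in; rewrite -lee_fin (le_trans b_le) //.
apply: le_trans (_ : (rho1 Sigma t <= _)%E).
  by apply: ereal_inf_lbound; exists t => //; rewrite /= in_itv.
apply: le_trans (bigmin_le_cond +oo%E (fun i => sing_gap (Sigma ord0 t) (Sigma i t)) i0) _.
pose gap s := (\big[mine/+oo]_(s' <- singular_values (Sigma i t)) `|s - s'|%:E)%E.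
apply: le_trans (bigmine_le_seq gap s1in) _.
exact: (bigmine_le_seq (fun s => `|s1 - s|%:E) s2in).
Qed.

Lemma rho1_hat_min_le_rho1_min : (rho1_hat_min Sigma <= rho1_min Sigma)%E.
Proof.
apply: le_ereal_inf_tmp => _ [t t01 <-].
apply: le_trans (_ : (rho1_hat Sigma t <= _)%E); last by rewrite ge_min lexx.
by apply: ereal_inf_lbound; exists t.
Qed.

Lemma rho1_hat_min_le_sing (a t : R) : (a%:E <= rho1_hat_min Sigma)%E -> 0 <= t <= 1 ->
  forall s, s \in singular_values (Sigma ord0 t) -> a <= s.
Proof.
move=> a_le t01 s sin; rewrite -lee_fin (le_trans a_le) //.
apply: le_trans (_ : (rho1_hat Sigma t <= _)%E).
  by apply: ereal_inf_lbound; exists t => //; rewrite /= in_itv.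
by rewrite ge_min (bigmine_le_seq EFin sin) orbT.
Qed.

Lemma rho1_hat_min_lty : (0 < r ord0)%N -> (rho1_hat_min Sigma < +oo)%E.
Proof.
move=> r0; pose s := sv (Sigma ord0 0) (Ordinal r0).
apply: le_lt_trans (_ : (_ <= s%:E)%E) (ltry s).
apply: le_trans (_ : (rho1_hat Sigma 0 <= _)%E).
  by apply: ereal_inf_lbound; exists 0 => //; rewrite /= in_itv /= lexx ler01.
by rewrite ge_min (bigmine_le_seq EFin (sv_mem _ (Ordinal r0))) orbT.
Qed.

End ExtendedGaps.

(** * Passage to extended real weights *)

Section LimitingWeights.
Variable R : realType.
Implicit Types d s u v w g : R.

Lemma unbounded_weight_eq0 (c v g b0 : R) : 0 < c -> 0 <= v ->
  (forall b, b0 <= b -> c * (b ^+ 2 * v) <= g) -> v = 0.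
Proof.
move=> c0 v0 bnd; apply/eqP; rewrite -[_ == _]negbK; apply/negP => vn0.
have cv0 : 0 < c * v by rewrite mulr_gt0 // lt_neqAle eq_sym vn0.
(* Since [1 <= b], the square of [b] may be replaced by [b]. *)
pose b := `|b0| + `|g| / (c * v) + 1.
have b1 : 1 <= b by rewrite lerDr addr_ge0 // divr_ge0 // ltW.
have b0b : b0 <= b.
  by rewrite /b -addrA (le_trans (ler_norm b0)) // lerDl addr_ge0 // divr_ge0 // ltW.
have bg : g < b * (c * v).
  apply: le_lt_trans (ler_norm g) _.
  have -> : `|g| = `|g| / (c * v) * (c * v) by rewrite divfK // gt_eqF.
  by rewrite ltr_pM2r // /b; have := normr_ge0 b0; lra.
have := bnd b b0b; rewrite mulrCA => le_g.
have : b * (c * v) <= b ^+ 2 * (c * v).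
  by rewrite ler_pM2r // expr2 ler_peMr // (le_trans ler01).
by move=> /le_trans/(_ le_g); rewrite leNgt bg.
Qed.

(** Divide by [a^2] and let [a] tend to infinity. *)
Lemma le_of_relative_weights (d s g : R) : 0 <= d -> 0 <= s ->
  (forall a, d < a -> (a - d) ^+ 2 * s <= a ^+ 2 * g) -> s <= g.
Proof.
move=> d0 s0 bnd; rewrite leNgt; apply/negP => gs.
have e0 : 0 < s - g by rewrite subr_gt0.
(* Any [a] beyond [2 d s / (s - g)] contradicts the bound, which reads
   [a (s - g) <= 2 d s - d^2 s / a]. *)
pose a := d + 2 * d * s / (s - g) + 1.
have q0 : 0 <= 2 * d * s / (s - g) by rewrite divr_ge0 ?mulr_ge0 // ltW.
have da : d < a by rewrite /a; lra.
have a_gt0 : 0 < a by rewrite (le_lt_trans d0).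
have le1 : a * (s - g) <= 2 * d * s.
  rewrite -(ler_pM2l a_gt0); have := bnd a da.
  have : 0 <= d ^+ 2 * s by rewrite mulr_ge0 ?sqr_ge0.
  lra.
have : 2 * d * s < a * (s - g).
  rewrite -ltr_pdivrMr // /a; lra.
by rewrite ltNge le1.
Qed.

End LimitingWeights.

Section ExtendedInequalities.
Variable R : realType.
Variables (d s w v g : R) (rho rhoh : \bar R).
Hypotheses (d0 : 0 <= d) (s0 : 0 <= s) (w0 : 0 <= w) (v0 : 0 <= v).

(** If [rho] is infinite, the real bound holds for all large [b], which forces [v = 0],
and the third term vanishes. *)
Lemma rectangular_inequality :
  (rhoh <= rho)%E -> (rhoh < +oo)%E ->
  (forall a b : R, d < a -> a <= b -> (a%:E <= rhoh)%E -> (b%:E <= rho)%E ->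
    (a - d) ^+ 2 * (2 * s + a ^+ 2 * w + b ^+ 2 * v) <= a ^+ 2 * g) ->
  (d%:E < rhoh)%E ->
  (2%:E * s%:E + rhoh ^+ 2 * w%:E + rho ^+ 2 * v%:E
     <= (rhoh / (rhoh - d%:E)) ^+ 2 * g%:E)%E.
Proof.
move=> le_rho lty bnd; move: le_rho lty bnd; case: rhoh => [a| |] // le_rho _ bnd.
rewrite lte_fin => da.
have ad0 : 0 < a - d by rewrite subr_gt0.
have fin b : a <= b -> (b%:E <= rho)%E ->
    2 * s + a ^+ 2 * w + b ^+ 2 * v <= (a / (a - d)) ^+ 2 * g.
  move=> ab brho; rewrite expr_div_n [leRHS]mulrAC ler_pdivlMr ?exprn_gt0 // mulrC.
  exact: bnd.
rewrite -EFinB inver gt_eqF // -(EFinM a) -!EFin_expe -!EFinM -EFinD.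
case: rho le_rho fin {bnd} => [b| |] //.
  by rewrite lee_fin => ab /(_ b ab (lexx _)); rewrite -EFin_expe -EFinM -EFinD lee_fin.
move=> _ fin.
have vE : v = 0.
  apply: (@unbounded_weight_eq0 R 1 v ((a / (a - d)) ^+ 2 * g) a) => // b ab.
  rewrite mul1r; apply: le_trans (fin b ab (leey _)).
  by rewrite lerDr addr_ge0 // mulr_ge0 // sqr_ge0.
rewrite vE mule0 adde0 lee_fin; apply: le_trans (fin a (lexx _) (leey _)).
by rewrite lerDl mulr_ge0 // sqr_ge0.
Qed.

(** If [rho] is infinite, the real bound holds for all large [a]: this forces
[w + v = 0] and, in the limit, [2 s <= g]. *)
Lemma square_inequality :
  (forall a : R, d < a -> (a%:E <= rho)%E ->
    (a - d) ^+ 2 * (2 * s + a ^+ 2 * w + a ^+ 2 * v) <= a ^+ 2 * g) ->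
  (d%:E < rho)%E ->
  (2%:E * (1 - d%:E / rho) ^+ 2 * s%:E + (rho - d%:E) ^+ 2 * (w + v)%:E <= g%:E)%E.
Proof.
case: rho => [a| |] // bnd.
  rewrite lte_fin => da; have a_gt0 : 0 < a by rewrite (le_lt_trans d0).
  rewrite inver gt_eqF // -(EFinM d) -!EFinB -!EFin_expe -!EFinM -EFinD lee_fin.
  rewrite -(ler_pM2l (exprn_gt0 2 a_gt0)); apply: le_trans (bnd a da (lexx _)).
  by rewrite le_eqVlt; apply/orP; left; apply/eqP; field; rewrite gt_eqF.
move=> _; have {}bnd a (da : d < a) := bnd a da (leey _).
have wv : w + v = 0.
  apply: (@unbounded_weight_eq0 R 1 _ g 1) => [//||b b_ge]; first exact: addr_ge0.
  have b0 : 0 < b := lt_le_trans ltr01 b_ge.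
  have bd0 : 0 < b + d by rewrite ltr_wpDr.
  have := bnd (b + d); rewrite ltrDr b0 addrK => /(_ isT) le_g.
  rewrite mul1r -(ler_pM2l (exprn_gt0 2 bd0)) (le_trans _ le_g) //.
  by rewrite mulrCA ler_wpM2l ?sqr_ge0 // mulrDr -addrA lerDr mulr_ge0.
have sg : 2 * s <= g.
  apply: (le_of_relative_weights d0); first by rewrite mulr_ge0.
  move=> a da; apply: le_trans (bnd a da).
  by rewrite ler_wpM2l ?sqr_ge0 // -addrA -mulrDr wv mulr0 addr0.
rewrite invey mule0 sube0 -EFin_expe expr1n mule1 wv mule0 adde0 -EFinM lee_fin //.
Qed.

End ExtendedInequalities.

(* n is \sum_j r j, m is n + p; W j (j < k.+1) and Wlast are the column blocks
   of the left unitary factor. *)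
Theorem theorem3p2 (R : realType) (k p : nat) (r : 'I_k.+1 -> nat)
    (r_gt0 : forall j, (0 < r j)%N)
    (B DB : 'M[R[i]]_((\sum_j r j) + p, \sum_j r j))
    (Sigma : forall j : 'I_k.+1, R -> 'M[R[i]]_(r j))
    (W : forall j : 'I_k.+1, R -> 'M[R[i]]_((\sum_j r j) + p, r j))
    (Wlast : R -> 'M[R[i]]_((\sum_j r j) + p, p))
    (V : forall j : 'I_k.+1, R -> 'M[R[i]]_(\sum_j r j, r j))
    (Sigma_analytic : forall j, analytic_mx (Sigma j))
    (W_analytic : analytic_mx (fun t => row_mx (\mxrow_j W j t) (Wlast t)))
    (V_analytic : analytic_mx (fun t => \mxrow_j V j t))
    (W_unitary : forall t, row_mx (\mxrow_j W j t) (Wlast t) \is unitarymx)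
    (V_unitary : forall t, \mxrow_j V j t \is unitarymx)
    (B_decomp : forall t : R,
      B + t%:C%C *: DB =
        row_mx (\mxrow_j W j t) (Wlast t)
          *m col_mx (\mxdiag_j Sigma j t) 0
          *m (\mxrow_j V j t) ^t*)
    (W_deriv : forall j t, (W j t) ^t* *m deriv_mx (W j) t = 0)
    (Wlast_deriv : forall t, (Wlast t) ^t* *m deriv_mx Wlast t = 0)
    (V_deriv : forall j t, (V j t) ^t* *m deriv_mx (V j) t = 0) :
  let W1 := W ord0 0 in
  let W1' := W ord0 1 in
  let V1 := V ord0 0 in
  let V1' := V ord0 1 in
  let dSing := Sing_dec (Sigma ord0 1) - Sing_dec (Sigma ord0 0) in
  let rho := rho1_min Sigma in
  let rhoh := rho1_hat_min Sigma in
  let d := (specnorm DB)%:E in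
  ((d < rhoh)%E ->
   (2%:E * (frobnorm dSing ^+ 2)%:E
      + rhoh ^+ 2 * (frobnorm (W1' - W1) ^+ 2)%:E
      + rho ^+ 2 * (frobnorm (V1' - V1) ^+ 2)%:E
    <= (rhoh / (rhoh - d)) ^+ 2
       * (frobnorm (DB *m V1) ^+ 2 + frobnorm (W1 ^t* *m DB) ^+ 2)%:E)%E)
  /\
  (p = 0%N -> (d < rho)%E ->
   (2%:E * (1 - d / rho) ^+ 2 * (frobnorm dSing ^+ 2)%:E
      + (rho - d) ^+ 2
        * (frobnorm (W1' - W1) ^+ 2 + frobnorm (V1' - V1) ^+ 2)%:E
    <= (frobnorm (DB *m V1) ^+ 2 + frobnorm (W1 ^t* *m DB) ^+ 2)%:E)%E).

Proof.
have real_bound (a b : R) : specnorm DB < a -> a <= b -> (b%:E <= rho1_min Sigma)%E ->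
    (p = 0%N \/ (a%:E <= rho1_hat_min Sigma)%E) ->
    (a - specnorm DB) ^+ 2 *
      (2 * frobnorm (Sing_dec (Sigma ord0 1) - Sing_dec (Sigma ord0 0)) ^+ 2
       + a ^+ 2 * frobnorm (W ord0 1 - W ord0 0) ^+ 2
       + b ^+ 2 * frobnorm (V ord0 1 - V ord0 0) ^+ 2)
    <= a ^+ 2 * (frobnorm (DB *m V ord0 0) ^+ 2 + frobnorm ((W ord0 0)^t* *m DB) ^+ 2).
  move=> da ab b_le a_le; rewrite !frobnorm_sqr.
  apply: (block_perturbation_bound Sigma_analytic W_analytic V_analytic W_unitary V_unitary
            B_decomp (W_deriv ord0) (V_deriv ord0)) => //.
  - by move=> t t01; exact: rho1_min_gap.
  - by case: a_le => [->|a_le]; [left|right => t t01; exact: rho1_hat_min_le_sing].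
split.
  apply: rectangular_inequality; rewrite ?sqr_ge0 //.
  - exact: rho1_hat_min_le_rho1_min.
  - exact: rho1_hat_min_lty.
  - by move=> a b da ab a_le b_le; apply: real_bound => //; right.
move=> p0; apply: square_inequality; rewrite ?sqr_ge0 ?specnorm_ge0 //.
by move=> a da a_le; apply: real_bound => //; left.
Qed.
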